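(* Let $G$ be a small profinite group. Then there exist a set $I \subseteq \mathbb{N}$ and nontrivial indecomposable profinite groups $\{G_n\}_{n\in I}$ such that $G\cong \prod_{n \in I} G_n$. Moreover, if $G\cong \prod_{i\in I} H_i$ and $G\cong \prod_{j\in J} G_j$ are two decompositions of $G$ into direct products of nontrivial indecomposable profinite groups (over arbitrary index sets $I$ and $J$), then there is a bijection $h:I\to J$ such that $H_i\cong G_{h(i)}$ for every $i\in I$.
   Context: All homomorphisms and isomorphisms between profinite groups are required to be continuous, and direct products carry the product topology. A profinite group $G$ is small if for every $n\in\mathbb{N}$ it has only finitely many open normal subgroups of index $n$. A profinite group $G$ is indecomposable if whenever $G\cong A\times B$ as profinite groups, either $A$ or $B$ is trivial. *)

(* Defs.v *)
(* MathComp: monoid.v's groupType (arbitrary, possibly infinite, groups) with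
   the topology of MathComp-Analysis. *)
From HB Require Import structures.
From mathcomp Require Import all_boot.
From mathcomp Require Import all_classical topology.
Set Implicit Arguments.
Unset Strict Implicit.
Unset Printing Implicit Defensive.

Local Open Scope classical_set_scope.
Local Open Scope group_scope.

#[short(type="preTopologicalGroupType")]
HB.structure Definition PreTopologicalGroup := {G of Topological G & Group G}.

HB.mixin Record PreTopologicalGroup_isTopologicalGroup G
    & PreTopologicalGroup G := {
  mulg_continuous : continuous (fun x : G * G => x.1 * x.2);
  invg_continuous : continuous (fun x : G => x^-1)
}.

#[short(type="topologicalGroupType")]
HB.structure Definition TopologicalGroup :=
  {G of PreTopologicalGroup G & PreTopologicalGroup_isTopologicalGroup G}.

(* A profinite group is a compact Hausdorff totally disconnected topological
   group. *)
HB.mixin Record TopologicalGroup_isProfinite G & TopologicalGroup G := {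
  profinite_compact : compact [set: G];
  profinite_hausdorff : hausdorff_space G;
  profinite_totally_disconnected : totally_disconnected [set: G]
}.

#[short(type="profiniteGroupType")]
HB.structure Definition ProfiniteGroup :=
  {G of TopologicalGroup G & TopologicalGroup_isProfinite G}.

Section PairTopologicalGroup.
Variables A B : topologicalGroupType.

Let pair_mulg_continuous :
  continuous (fun x : (A * B) * (A * B) => x.1 * x.2).
Proof.
move=> x; apply: cvg_pair => /=.
- apply: (@continuous_comp _ _ _
    (fun x : (A * B) * (A * B) => (x.1.1, x.2.1)) (fun y : A * A => y.1 * y.2)).
    by apply: cvg_pair; apply: continuous_comp;
      [exact: cvg_fst|exact: cvg_fst|exact: cvg_snd|exact: cvg_fst].
  exact: mulg_continuous.
- apply: (@continuous_comp _ _ _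
    (fun x : (A * B) * (A * B) => (x.1.2, x.2.2)) (fun y : B * B => y.1 * y.2)).
    by apply: cvg_pair; apply: continuous_comp;
      [exact: cvg_fst|exact: cvg_snd|exact: cvg_snd|exact: cvg_snd].
  exact: mulg_continuous.
Qed.

Let pair_invg_continuous : continuous (fun x : A * B => x^-1).
Proof.
move=> x; apply: cvg_pair => /=.
- by apply: continuous_comp; [exact: cvg_fst|exact: invg_continuous].
- by apply: continuous_comp; [exact: cvg_snd|exact: invg_continuous].
Qed.

HB.instance Definition _ := PreTopologicalGroup_isTopologicalGroup.Build
  (A * B)%type pair_mulg_continuous pair_invg_continuous.

End PairTopologicalGroup.

Section PairProfiniteGroup.
Variables A B : profiniteGroupType.

Let pair_compact : compact [set: A * B].
Proof. by rewrite -setXTT; apply: compact_setX; exact: profinite_compact. Qed.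

Let pair_hausdorff : hausdorff_space (A * B)%type.
Proof.
have cmap (C : topologicalType) (f : A * B -> C) p q :
    continuous f -> cluster (nbhs p) q -> cluster (nbhs (f p)) (f q).
  move=> cf pq U V Up Vq.
  by have [z [Uz Vz]] := pq _ _ (cf _ _ Up) (cf _ _ Vq); exists (f z).
move=> [a b] [a' b'] pq; congr pair; apply: profinite_hausdorff.
- by apply: (cmap _ fst _ _ _ pq) => x; exact: cvg_fst.
- by apply: (cmap _ snd _ _ _ pq) => x; exact: cvg_snd.
Qed.

Let pair_totally_disconnected : totally_disconnected [set: A * B].
Proof.
have cc (C : profiniteGroupType) (f : A * B -> C) (D : set (A * B)) x y :
    continuous f -> connected D -> D x -> D y -> f x = f y.
  move=> cf cD Dx Dy; suff: connected_component [set: C] (f x) (f y).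
    by rewrite profinite_totally_disconnected //= => ->.
  exists (f @` D); last by exists y.
  split; [by exists x| by [] |].
  by apply: connected_continuous_connected => //; exact: continuous_subspaceT.
move=> x _; rewrite eqEsubset; split; last first.
  by move=> _ ->; exact: connected_component_refl.
move=> y [D [Dx _ cD] Dy]; rewrite (surjective_pairing x) (surjective_pairing y).
congr pair.
- by apply: (cc A fst D y x) => // z; exact: cvg_fst.
- by apply: (cc B snd D y x) => // z; exact: cvg_snd.
Qed.

HB.instance Definition _ := TopologicalGroup_isProfinite.Build (A * B)%type
  pair_compact pair_hausdorff pair_totally_disconnected.

End PairProfiniteGroup.

Section ProdTopologicalGroup.
Variables (I : Type) (T : I -> topologicalGroupType).
Implicit Types f g h : prod_topology T.

Let one : prod_topology T := fun=> 1.
Let inv f : prod_topology T := fun i => (f i)^-1.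
Let mul f g : prod_topology T := fun i => f i * g i.

Let mulA : associative mul.
Proof. by move=> f g h; apply: (@functional_extensionality_dep I T) => i; exact: mulgA. Qed.

Let mul1 : left_id one mul.
Proof. by move=> f; apply: (@functional_extensionality_dep I T) => i; exact: mul1g. Qed.

Let mulr1 : right_id one mul.
Proof. by move=> f; apply: (@functional_extensionality_dep I T) => i; exact: mulg1. Qed.

Let mulV : left_inverse one inv mul.
Proof. by move=> f; apply: (@functional_extensionality_dep I T) => i; exact: mulVg. Qed.

Let mulrV : right_inverse one inv mul.
Proof. by move=> f; apply: (@functional_extensionality_dep I T) => i; exact: mulgV. Qed.

HB.instance Definition _ :=
  isGroup.Build (prod_topology T) mulA mul1 mulr1 mulV mulrV.

Let projT i : continuous (fun f : prod_topology T => f i).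
Proof. exact: (@proj_continuous {classic I} T i). Qed.

Let into_prod (X : topologicalType) (u : X -> prod_topology T) :
  (forall i, continuous (fun x => u x i)) -> continuous u.
Proof.
move=> cu x; apply: (cvg_sup _ _ _).2 => i.
exact: (@continuous_comp_initial _ X (T i)
  (fun f : prod_topology T => f i) u (cu i) x).
Qed.

Let prod_mulg_continuous :
  continuous (fun x : prod_topology T * prod_topology T => x.1 * x.2).
Proof.
apply: into_prod => i x.
apply: (@continuous_comp _ _ _
  (fun x : prod_topology T * prod_topology T => (x.1 i, x.2 i))
  (fun y : T i * T i => y.1 * y.2)); last exact: mulg_continuous.
apply: cvg_pair.
- by apply: (@continuous_comp _ _ _ fst (fun f : prod_topology T => f i));
    [exact: cvg_fst|exact: projT].
- by apply: (@continuous_comp _ _ _ snd (fun f : prod_topology T => f i));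
    [exact: cvg_snd|exact: projT].
Qed.

Let prod_invg_continuous : continuous (fun f : prod_topology T => f^-1).
Proof.
apply: into_prod => i f.
apply: (@continuous_comp _ _ _
  (fun f : prod_topology T => f i) (fun y : T i => y^-1)).
  exact: projT.
exact: invg_continuous.
Qed.

HB.instance Definition _ := PreTopologicalGroup_isTopologicalGroup.Build
  (prod_topology T) prod_mulg_continuous prod_invg_continuous.

End ProdTopologicalGroup.

Section ProdProfiniteGroup.
Variables (I : Type) (T : I -> profiniteGroupType).

Let prod_compact : compact [set: prod_topology T].
Proof.
have -> : [set: prod_topology T] = [set f | forall i, [set: T i] (f i)].
  by rewrite eqEsubset; split.
exact: (@tychonoff {classic I} T _ (fun i => @profinite_compact (T i))).
Qed.

Let prod_hausdorff : hausdorff_space (prod_topology T).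
Proof.
exact: (@hausdorff_product {classic I} T (fun i => @profinite_hausdorff (T i))).
Qed.

Let prod_totally_disconnected : totally_disconnected [set: prod_topology T].
Proof.
have -> : [set: prod_topology T] = (fun f => forall i, [set: T i] (f i)).
  by rewrite eqEsubset; split.
exact: (@totally_disconnected_prod {classic I} T _
  (fun i => @profinite_totally_disconnected (T i))).
Qed.

HB.instance Definition _ := TopologicalGroup_isProfinite.Build
  (prod_topology T) prod_compact prod_hausdorff prod_totally_disconnected.

End ProdProfiniteGroup.

(* An isomorphism of topological groups is required to be continuous in both
   directions. *)
Definition isomorphic (G H : topologicalGroupType) : Prop :=
  exists (f : G -> H) (g : H -> G),
    [/\ monoid_morphism f, continuous f, continuous g, cancel f g & cancel g f].

Definition trivial_group (G : groupType) : Prop := forall x : G, x = 1.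

(* As such, the trivial group is indecomposable; nontriviality is always a
   separate requirement. *)
Definition indecomposable (G : profiniteGroupType) : Prop :=
  forall A B : profiniteGroupType,
    isomorphic G (A * B)%type -> trivial_group A \/ trivial_group B.

Definition normal_subgroup (G : groupType) (N : set G) : Prop :=
  group_closed (mem N) /\ forall x y : G, N x -> N (x ^ y).

Definition left_cosets (G : groupType) (N : set G) : set (set G) :=
  [set [set x * y | y in N] | x in [set: G]].

Definition has_index (G : groupType) (N : set G) (n : nat) : Prop :=
  (left_cosets N #= `I_n)%card.

Definition small (G : profiniteGroupType) : Prop :=
  forall n : nat,
    finite_set [set N : set G | [/\ open N, normal_subgroup N & has_index N n]].

(* A direct product of profinite groups is [prod_topology F], that is
   [forall i, F i] with pointwise operations and the product topology. *)
Definition indecomposable_decomposition (G : profiniteGroupType) (I : Type)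
    (F : I -> profiniteGroupType) : Prop :=
  (forall i, ~ trivial_group (F i) /\ indecomposable (F i)) /\
  isomorphic G (prod_topology F).

(* Main.v *)
(* Direct factors of a profinite group G correspond to the idempotent
   continuous endomorphisms commuting with all inner automorphisms ("normal"
   endomorphisms).  If G is small, the intersections M_n of the open normal
   subgroups of index at most n are open and fully invariant and form a basis
   at 1, so the normal endomorphisms form a compact space for pointwise
   convergence.

   Existence: by compactness and Zorn's lemma, every direct factor not contained
   in M_n has an indecomposable direct factor not contained in M_n.  Split off
   such factors one after another, n being minimal each time; as G / M_n is
   finite, the remaining factors eventually lie in every M_n, so they shrink to 1
   and G is the product of the factors split off.

   Uniqueness: an idempotent in a compact semigroup of endomorphisms yields
   Fitting's lemma for indecomposable factors, hence the exchange property, and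
   one pair of isomorphic factors can be cancelled.  Each isomorphism class
   occurs only finitely often in a decomposition (finitely many factors are not
   contained in a given M_n), so counting by cancellation matches the classes. *)
From HB Require Import structures.
Require Import Defs.
From mathcomp Require Import all_boot.
From mathcomp Require Import all_classical topology.
Set Implicit Arguments.
Unset Strict Implicit.
Unset Printing Implicit Defensive.

Local Open Scope classical_set_scope.
Local Open Scope group_scope.

(** * Compact spaces and bases of open normal subgroups *)

(** A downward directed family of nonempty sets generates a proper filter, and a cluster point of
    this filter lies in every closed member. Nearly all compactness arguments below take this
    form. *)
Lemma directed_closed_nonempty (X : topologicalType) (I : Type) (i0 : I)
    (D : I -> set X) :
  compact [set: X] -> (forall i, closed (D i)) -> (forall i, D i !=set0) ->
  (forall i j, exists k, D k `<=` D i `&` D j) -> exists x, forall i, D i x.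
Proof.
move=> cX Dcl D0 Ddir.
have FF : ProperFilter (filter_from [set: I] D).
  apply: filter_from_proper => //; apply: filter_from_filter; first by exists i0.
  by move=> i j _ _; have [k Dk] := Ddir i j; exists k.
have [x [_ clx]] := cX _ FF filterT.
exists x => i; apply: Dcl => B xB.
by apply: clx => //; exists i.
Qed.

Lemma continuous_bij_inverse (X Y : topologicalType) (f : X -> Y) (g : Y -> X) :
  compact [set: X] -> hausdorff_space Y -> continuous f ->
  cancel f g -> cancel g f -> continuous g.
Proof.
move=> cX hY cf fK gK; apply/continuous_closedP => A clA.
have -> : g @^-1` A = f @` A.
  rewrite eqEsubset; split => [y /= Agy|_ [x Ax <-] /=]; last by rewrite fK.
  by exists (g y).
apply: compact_closed => //; apply: continuous_compact.
  exact: continuous_subspaceT.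
exact: subclosed_compact cX _.
Qed.

(** In a compact Hausdorff space the quasi-component [Q] of [x], the intersection of the clopen sets
    containing [x], is connected. Here it is therefore [{x}], and compactness puts one of these
    clopen sets inside [U]. *)
Lemma totally_disconnected_clopen_nbhs (X : topologicalType) (x : X) (U : set X) :
  compact [set: X] -> hausdorff_space X -> totally_disconnected [set: X] ->
  nbhs x U -> exists C, [/\ clopen C, C x & C `<=` U].
Proof.
move=> cX hX tdX Ux.
pose K := {C : set X | clopen C /\ C x}.
have K0 : K by exists setT; split => //; exact: clopenT.
pose Q := [set y | forall C : K, sval C y].
have Qcl : closed Q.
  have -> : Q = \bigcap_(C in [set: K]) sval C.
    by rewrite eqEsubset; split => y Qy C; [move=> _; exact: Qy|exact: Qy].
  by apply: closed_bigI => -[C [[]]].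
have small_clopen V : open V -> Q `<=` V -> exists C : K, sval C `<=` V.
  move=> oV QV; apply: contrapT => nV.
  have [|||y Dy] := @directed_closed_nonempty X K K0 (fun C => sval C `&` ~` V) cX.
  - by move=> [C [[oC cC] Cx]]; apply: closedI => //; exact: open_closedC.
  - move=> C; apply: contrapT => CV; apply: nV; exists C => y Cy.
    by apply: contrapT => nVy; apply: CV; exists y.
  - move=> [C [cC Cx]] [C' [cC' Cx']].
    exists (exist _ (C `&` C') (conj (clopenI cC cC') (conj Cx Cx'))) => /= y.
    by move=> [[]].
  have := Dy K0 => -[_]; apply; apply: QV => C; exact: (Dy C).1.
(* Normality gives an open [V] around [S] whose closure misses [S']. A clopen [C] inside the union
   of [V] and the complement of its closure makes [C] and [V] meet in a clopen set containing [x].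
   That set contains [Q] and misses [S']. *)
have Qpart S S' : closed S -> closed S' -> S x -> S `&` S' = set0 ->
    Q = S `|` S' -> S' = set0.
  move=> clS clS' Sx SS' QE.
  have [] := @compact_normal _ hX cX S clS (~` S').
    apply/set_nbhsP; exists (~` S'); split => //; first exact: closed_openC.
    by apply/disjoints_subset.
  move=> W /set_nbhsP[V [oV SV VW]] WS'.
  have VS' : closure V `<=` ~` S' by apply: subset_trans WS'; exact: closureS.
  have oV' : open (~` closure V) by apply: closed_openC; exact: closed_closure.
  have [||[C [[oC cC] Cx]] /= CV] := small_clopen (V `|` ~` closure V).
  - exact: openU.
  - by rewrite QE => y [/SV|S'y]; [left|right => /VS'].
  have CVc : C `&` V = C `&` ~` ~` closure V.
    rewrite eqEsubset setCK; split => y [Cy Vy]; split => //.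
      exact: subset_closure.
    by have [] := CV _ Cy.
  have clopCV : clopen (C `&` V).
    split; first exact: openI.
    by rewrite CVc setCK; apply: closedI => //; exact: closed_closure.
  rewrite -subset0 => y S'y.
  have Qy : Q y by rewrite QE; right.
  have [_ /subset_closure/VS'] := Qy (exist _ (C `&` V) (conj clopCV (conj Cx (SV _ Sx)))).
  exact.
have Qcon : connected Q.
  move=> B [b Bb] [O oO BO] [F clF BF].
  have clA : closed (Q `&` ~` O) by apply: closedI => //; exact: open_closedC.
  have clB : closed B by rewrite BF; exact: closedI.
  have AB0 : (Q `&` ~` O) `&` B = set0.
    by rewrite BO -subset0 => y [[_ nOy] [_ /nOy]].
  have QE : Q = (Q `&` ~` O) `|` B by rewrite BO -setIUr setUC setUv setIT.
  have [Bx|nBx] := pselect (B x).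
    have A0 : Q `&` ~` O = set0.
      by apply: (Qpart B) => //; [rewrite setIC|rewrite setUC].
    by rewrite QE A0 set0U.
  have Ax : (Q `&` ~` O) x.
    have : (Q `&` ~` O `|` B) x by rewrite -QE => -[C []].
    by case.
  by move: Bb; rewrite (Qpart _ _ clA clB Ax AB0 QE).
have Qx : Q `<=` [set x].
  rewrite -(tdX x I) => y Qy; exists Q => //; split => //.
  by move=> [C []].
move: Ux; rewrite nbhsE => -[V [oV Vx] VU].
have [|[C [cC Cx]] /= CV] := small_clopen V oV; first by move=> y /Qx ->.
by exists C; split => //; exact: subset_trans VU.
Qed.

Section ContinuousGroupOps.
Variables (X : topologicalType) (G : topologicalGroupType).
Implicit Types f g : X -> G.

Lemma continuous_mulg f g :
  continuous f -> continuous g -> continuous (fun x => f x * g x).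
Proof.
move=> cf cg x.
apply: (@continuous_comp _ _ _ (fun x => (f x, g x)) (fun y : G * G => y.1 * y.2)).
  by apply: cvg_pair; [exact: cf|exact: cg].
exact: mulg_continuous.
Qed.

Lemma continuous_invg f : continuous f -> continuous (fun x => (f x)^-1).
Proof.
move=> cf x; apply: (@continuous_comp _ _ _ f (fun y : G => y^-1)); first exact: cf.
exact: invg_continuous.
Qed.

Lemma continuous_conjg f g :
  continuous f -> continuous g -> continuous (fun x => f x ^ g x).
Proof.
move=> cf cg; apply: continuous_mulg; first exact: continuous_invg.
exact: continuous_mulg.
Qed.

End ContinuousGroupOps.

Lemma continuous_compf (X Y Z : topologicalType) (f : X -> Y) (g : Y -> Z) :
  continuous f -> continuous g -> continuous (fun x => g (f x)).
Proof. by move=> cf cg x; apply: continuous_comp; [exact: cf|exact: cg]. Qed.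

Lemma continuous_pair (X Y Z : topologicalType) (f : X -> Y) (g : X -> Z) :
  continuous f -> continuous g -> continuous (fun x => (f x, g x)).
Proof. by move=> cf cg x; apply: cvg_pair; [exact: cf|exact: cg]. Qed.

Lemma continuous_const (X Y : topologicalType) (c : Y) :
  continuous (fun _ : X => c).
Proof. by move=> x; exact: cvg_cst. Qed.

Lemma nbhs1_setC1 (G : profiniteGroupType) (x : G) : x <> 1 -> nbhs 1 (~` [set x]).
Proof.
move=> x1; apply: open_nbhs_nbhs; split; last by move=> /= h1; exact: x1.
by apply/closed_openC/accessible_closed_set1/hausdorff_accessible/profinite_hausdorff.
Qed.

Lemma normal_subgroupP (G : groupType) (N : set G) :
  normal_subgroup N <->
  [/\ N 1, forall x y, N x -> N y -> N (x / y) & forall x y, N x -> N (x ^ y)].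
Proof.
split=> [[[N1 Nd] NJ]|[N1 Nd NJ]].
  split => // [|x y Nx Ny]; first exact/set_mem.
  by apply/set_mem/Nd; exact/mem_set.
split=> //; split; first exact/mem_set.
by move=> x y /set_mem Nx /set_mem Ny; apply/mem_set/Nd.
Qed.

(** For a clopen [C] between [1] and [U], take the elements all of whose conjugates, together with
    their inverses, map [C] into itself by right multiplication. They form a normal subgroup, which
    is inside [C] because [C] contains [1], and which is open because [G * C] is compact. *)
Lemma open_normal_subgroup_base (G : profiniteGroupType) (U : set G) :
  nbhs 1 U -> exists N, [/\ open N, normal_subgroup N & N `<=` U].
Proof.
move=> U1.
have [C [[oC cC] C1 CU]] := totally_disconnected_clopen_nbhs
  (@profinite_compact G) (@profinite_hausdorff G)
  (@profinite_totally_disconnected G) U1.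
pose P (x : G) (z : G * G) := C (z.2 * x ^ z.1) /\ C (z.2 / x ^ z.1).
pose K := [set: G] `*` C.
pose N := [set x | forall z, K z -> P x z].
have cK : compact K.
  apply: compact_setX; first exact: profinite_compact.
  exact: subclosed_compact cC (@profinite_compact G) _.
exists N; split.
- rewrite openE => x Nx; rewrite /interior.
  have := (compact_near_coveringP _).1 cK G (nbhs x) P _.
  apply => -[g y] Kgy; rewrite /P.
  have [Cp Cm] := Nx _ Kgy.
  have fst2 : continuous (fun w : (G * G) * G => w.1.1).
    by apply: (continuous_compf (f := fst) (g := fst)) => w; exact: cvg_fst.
  have snd2 : continuous (fun w : (G * G) * G => w.1.2).
    by apply: (continuous_compf (f := fst) (g := snd)) => w; [exact: cvg_fst|exact: cvg_snd].
  have snd1 : continuous (fun w : (G * G) * G => w.2) by move=> w; exact: cvg_snd.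
  have cJ : continuous (fun w : (G * G) * G => w.2 ^ w.1.1) by exact: continuous_conjg.
  have c1 : continuous (fun w : (G * G) * G => w.1.2 * w.2 ^ w.1.1).
    exact: continuous_mulg.
  have c2 : continuous (fun w : (G * G) * G => w.1.2 / w.2 ^ w.1.1).
    by apply: continuous_mulg => //; exact: continuous_invg.
  have n1 : nbhs ((g, y), x) [set w | C (w.1.2 * w.2 ^ w.1.1)] := c1 ((g, y), x) C (open_nbhs_nbhs (conj oC Cp)).
  have n2 : nbhs ((g, y), x) [set w | C (w.1.2 / w.2 ^ w.1.1)] := c2 ((g, y), x) C (open_nbhs_nbhs (conj oC Cm)).
  have FP : Filter (filter_prod (nbhs (g, y)) (nbhs x)) by exact: filter_prod_filter.
  by apply: (@filterS _ _ FP _ _ _ (@filterI _ _ FP _ _ n1 n2)) => w [w1 w2]; split.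
- apply/normal_subgroupP; split => [[g y] [_ Cy]|x x' Nx Nx' [g y] [_ Cy]|x h Nx [g y] [_ Cy]].
  + by rewrite /P /= conj1g invg1 mulg1.
  + have K1 z : C z -> K (g, z) by move=> Cz; split.
    have [/= + _] := Nx _ (K1 _ Cy); have [/= + _] := Nx' _ (K1 _ Cy).
    move=> /K1/Nx[/= _ +] /K1/Nx'[/= _ +].
    rewrite /P /= conjMg conjVg; move: (x ^ g) (x' ^ g) => a b.
    by rewrite invgF !mulgA.
  + by rewrite /P /= -conjgM; exact: (Nx (h * g, y)).
- move=> x Nx; apply: CU; have [] // := Nx (1, 1).
  by rewrite /= conjg1 mul1g.
Qed.

Lemma continuous_lmul (G : topologicalGroupType) (c : G) :
  continuous (fun x => c * x).
Proof.
apply: (@continuous_mulg G G (fun=> c) id) => x; first exact: cvg_cst.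
exact: cvg_id.
Qed.

(** * Fully invariant open subgroups *)

Lemma left_cosetE (G : groupType) (N : set G) (x : G) :
  [set x * y | y in N] = [set z | N (x^-1 * z)].
Proof.
rewrite eqEsubset; split => [_ [y Ny <-]|z Nz] /=; first by rewrite mulKg.
by exists (x^-1 * z) => //; rewrite mulVKg.
Qed.

Lemma open_subgroup_transversal (G : profiniteGroupType) (N : set G) :
  open N -> N 1 -> exists s : seq G, forall x, exists2 y, y \in s & N (y^-1 * x).
Proof.
move=> oN N1; apply: contrapT => nN.
pose D (s : seq G) := [set x | forall y, y \in s -> ~ N (y^-1 * x)].
have [|||x Dx] := @directed_closed_nonempty G _ [::] D (@profinite_compact G).
- move=> s; have -> : D s = \bigcap_(y in [set` s]) [set x | ~ N (y^-1 * x)] by [].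
  apply: closed_bigI => y _.
  apply: (@preimage_closed _ _ (fun x => y^-1 * x) (~` N)); last exact: open_closedC.
  by move=> x _; exact: continuous_lmul.
- move=> s; apply: contrapT => Ds; apply: nN; exists s => x.
  apply: contrapT => sx; apply: Ds; exists x => y ys Nyx.
  by apply: sx; exists y.
- move=> s t; exists (s ++ t) => x Dx; split => y ys; apply: Dx.
  + by rewrite mem_cat ys.
  + by rewrite mem_cat ys orbT.
- by apply: (Dx [:: x] x); rewrite ?inE// mulVg.
Qed.

Lemma finite_left_cosets (G : profiniteGroupType) (N : set G) :
  open N -> normal_subgroup N -> finite_set (left_cosets N).
Proof.
move=> oN /normal_subgroupP[N1 Nd _]; have [s sN] := open_subgroup_transversal oN N1.
have NV x : N x -> N x^-1 by move=> Nx; rewrite -div1g; exact: Nd.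
have NM x y : N x -> N y -> N (x * y).
  by move=> Nx Ny; rewrite -[y]invgK; apply: Nd => //; exact: NV.
apply: (@sub_finite_set _ _ ((fun x => [set x * y | y in N]) @` [set` s])).
  move=> _ [x _ <-]; have [y ys Nyx] := sN x; exists y => //=.
  rewrite !left_cosetE eqEsubset; split => z /= Nz.
    have -> : x^-1 * z = (y^-1 * x)^-1 * (y^-1 * z).
      by rewrite invgM invgK -mulgA mulVKg.
    by apply: NM => //; exact: NV.
  have -> : y^-1 * z = (y^-1 * x) * (x^-1 * z) by rewrite -mulgA mulVKg.
  exact: NM.
by apply: finite_image.
Qed.

(** Every left coset of the preimage is the preimage of a left coset of [N], so there are at most
    [n] of them. *)
Lemma preimage_index (G H : groupType) (f : G -> H) (N : set H) (n : nat) :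
  monoid_morphism f -> has_index N n ->
  exists2 k, k <= n & has_index (f @^-1` N) k.
Proof.
move=> [f1 fM] Nn.
have le : (left_cosets (f @^-1` N) #<= left_cosets N)%card.
  have : (left_cosets (f @^-1` N) #<=
          [set [set f x * y | y in N] | x in [set: G]])%card.
    have -> : left_cosets (f @^-1` N) =
        (fun B => f @^-1` B) @` [set [set f x * y | y in N] | x in [set: G]].
      have fV x : f x^-1 = (f x)^-1.
        by apply: (mulgI (f x)); rewrite -fM !mulgV.
      have E x : f @^-1` [set f x * y | y in N] = [set x * y | y in f @^-1` N].
        rewrite !left_cosetE.
        by rewrite eqEsubset; split => z /=; rewrite fM fV.
      rewrite eqEsubset; split => [_ [x _ <-]|_ [_ [x _ <-] <-]].
        by exists [set f x * y | y in N]; [exists x|rewrite E].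
      by exists x; rewrite // E.
    exact: card_image_le.
  move=> /card_le_trans; apply; apply: subset_card_le => _ [x _ <-].
  by exists (f x).
move: Nn; rewrite /has_index => Nn.
have len : (left_cosets (f @^-1` N) #<= `I_n)%card by rewrite -(card_le_eqr Nn).
have /finite_setP[k Nk] : finite_set (left_cosets (f @^-1` N)).
  by apply/finite_set_leP; exists n.
by exists k => //; rewrite -card_le_II -(card_le_eql Nk).
Qed.

(** Invariance is required under all continuous endomorphisms, not only the normal ones:
    [fi_base_retract] and [finite_class] apply it to endomorphisms of [G] built from maps between
    factors, which may fail to be normal. *)
Definition fi_subgroup (G : topologicalGroupType) (M : set G) :=
  [/\ open M, M 1, forall x y, M x -> M y -> M (x / y) &
    forall f : G -> G, continuous f -> monoid_morphism f ->
      forall x, M x -> M (f x)].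

(** This is the consequence of smallness on which uniqueness rests. It passes to retracts, hence to
    what remains of a product after a factor is cancelled. *)
Definition fi_base (G : topologicalGroupType) :=
  forall U : set G, nbhs 1 U -> exists2 M, fi_subgroup M & M `<=` U.

Lemma fi_base_separates (G : profiniteGroupType) (x : G) :
  fi_base G -> x <> 1 -> exists2 M, fi_subgroup M & ~ M x.
Proof. by move=> fiG /nbhs1_setC1/fiG[M fiM MU]; exists M => // /MU; apply. Qed.

Section FiSubgroup.
Variables (G : topologicalGroupType) (M : set G).
Hypothesis fiM : fi_subgroup M.

Lemma fi_open : open M. Proof. by case: fiM. Qed.

Lemma fi_one : M 1. Proof. by case: fiM. Qed.

Lemma fi_div x y : M x -> M y -> M (x / y). Proof. by case: fiM => _ _ H _; exact: H. Qed.

Lemma fi_inv x : M x -> M x^-1.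
Proof. by move=> Mx; rewrite -div1g; apply: fi_div => //; exact: fi_one. Qed.

Lemma fi_mul x y : M x -> M y -> M (x * y).
Proof. by move=> Mx My; rewrite -[y]invgK; apply: fi_div => //; exact: fi_inv. Qed.

Lemma fi_closed : closed M.
Proof.
have -> : M = ~` \bigcup_(x in ~` M) [set y | M (x^-1 * y)].
  rewrite eqEsubset; split => [x Mx [y nMy /= Myx]|x nMx].
    apply: nMy; rewrite -[y]invgK; apply: fi_inv.
    by rewrite -[_^-1](mulgK x); apply: fi_div.
  by apply: contrapT => Mx; apply: nMx; exists x => //=; rewrite mulVg; exact: fi_one.
apply: open_closedC; apply: bigcup_open => x _.
apply: (open_comp (f := fun y => x^-1 * y)); last exact: fi_open.
by move=> y _; exact: continuous_lmul.
Qed.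

End FiSubgroup.

Section Residual.
Variables (G : profiniteGroupType) (n : nat).

Let small_index : set (set G) := [set N |
  exists2 k, k <= n & [/\ open N, normal_subgroup N & has_index N k]].

Definition residual : set G := \bigcap_(N in small_index) N.

(** Smallness makes the intersection finite, hence open. It is fully invariant because the preimage
    under an endomorphism of an open normal subgroup of index at most [n] is again one. *)
Lemma residual_fi : small G -> fi_subgroup residual.
Proof.
move=> Gs; split.
- have fin : finite_set small_index.
    have -> : small_index = \bigcup_(k in `I_n.+1)
        [set N | [/\ open N, normal_subgroup N & has_index N k]].
      by rewrite eqEsubset; split => N [k]; exists k.
    by apply: bigcup_finite => [|k _]; [exact: finite_II|exact: Gs].
  rewrite -closedC setC_bigcap; apply: closed_bigcup => // N [k _ [oN _ _]].
  exact: open_closedC.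
- by move=> N [k _ [_ /normal_subgroupP[]]].
- move=> x y Mx My N Nn; have [k _ [_ /normal_subgroupP[_ Nd _] _]] := Nn.
  by apply: Nd; [exact: Mx|exact: My].
- move=> f cf mf x Mx N [k kn [oN nN Nk]].
  have [l lk Nl] := preimage_index mf Nk.
  apply: (Mx (f @^-1` N)); exists l; first exact: leq_trans kn.
  split => //; first by apply: open_comp oN => y _; exact: cf.
  case: mf => f1 fM.
  have fV y : f y^-1 = (f y)^-1 by apply: (mulgI (f y)); rewrite -fM !mulgV.
  move/normal_subgroupP: nN => [N1 Nd NJ]; apply/normal_subgroupP; split.
  + by rewrite /= f1.
  + by move=> y z /=; rewrite fM fV; exact: Nd.
  + by move=> y z /= Ny; rewrite conjgE !fM fV; exact: NJ.
Qed.

End Residual.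

Lemma residual_decreasing (G : profiniteGroupType) m n :
  m <= n -> residual n `<=` (residual m : set G).
Proof. by move=> mn x nx N [k km Nk]; apply: nx; exists k => //; exact: leq_trans mn. Qed.

Lemma residual_base (G : profiniteGroupType) (U : set G) :
  nbhs 1 U -> exists n, residual n `<=` U.
Proof.
move=> /open_normal_subgroup_base[N [oN nN NU]].
have /finite_setP[n Nn] := finite_left_cosets oN nN.
by exists n => x nx; apply: NU; apply: nx; exists n.
Qed.

Lemma small_fi_base (G : profiniteGroupType) : small G -> fi_base G.
Proof.
move=> Gs U /residual_base[n nU]; exists (residual n) => //; exact: residual_fi.
Qed.

(** * Normal endomorphisms *)

Definition nend (G : topologicalGroupType) (f : G -> G) :=
  [/\ continuous f, monoid_morphism f & forall x y, f (x ^ y) = f x ^ y].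

Section MonoidMorphism.
Variables (G H : groupType) (f : G -> H).
Hypothesis mf : monoid_morphism f.

Lemma monoid_morphism1 : f 1 = 1. Proof. exact: mf.1. Qed.

Lemma monoid_morphismM x y : f (x * y) = f x * f y. Proof. exact: mf.2. Qed.

Lemma monoid_morphismV x : f x^-1 = (f x)^-1.
Proof. by apply: (mulgI (f x)); rewrite -mf.2 !mulgV mf.1. Qed.

Lemma monoid_morphismJ x y : f (x ^ y) = f x ^ f y.
Proof. by rewrite conjgE !mf.2 monoid_morphismV. Qed.

Lemma monoid_morphism_inj : (forall x, f x = 1 -> x = 1) -> injective f.
Proof.
move=> fI x y fxy; apply: divg1_eq; apply: fI.
by rewrite mf.2 monoid_morphismV fxy mulgV.
Qed.

End MonoidMorphism.

Lemma monoid_morphism_comp (G H K : groupType) (f : G -> H) (g : H -> K) :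
  monoid_morphism f -> monoid_morphism g -> monoid_morphism (fun x => g (f x)).
Proof. by move=> [f1 fM] [g1 gM]; split => [|x y]; rewrite ?f1 ?fM. Qed.

Section Nend.
Variable G : topologicalGroupType.
Implicit Types f g : G -> G.

Lemma nend_continuous f : nend f -> continuous f. Proof. by case. Qed.

Lemma nend_morphism f : nend f -> monoid_morphism f. Proof. by case. Qed.

Lemma nend1 f : nend f -> f 1 = 1.
Proof. by move/nend_morphism => mf; exact: monoid_morphism1. Qed.

Lemma nendM f : nend f -> {morph f : x y / x * y}.
Proof. by case=> _ []. Qed.

Lemma nendV f x : nend f -> f x^-1 = (f x)^-1.
Proof. by move/nend_morphism => mf; exact: monoid_morphismV. Qed.

Lemma nendJ f x y : nend f -> f (x ^ y) = f x ^ y. Proof. by case. Qed.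

Lemma nend_id : nend (@id G).
Proof. by split => // x; exact: cvg_id. Qed.

Lemma nend_cst1 : nend (fun=> 1 : G).
Proof.
by split => [x||x y]; [exact: cvg_cst|split => [|x y]; rewrite ?mulg1|rewrite conj1g].
Qed.

Lemma nend_comp f g : nend f -> nend g -> nend (fun x => g (f x)).
Proof.
move=> nf ng; split.
- by apply: continuous_compf; exact: nend_continuous.
- by apply: monoid_morphism_comp; exact: nend_morphism.
- by move=> x y; rewrite !nendJ.
Qed.

Lemma fi_nend M f x : fi_subgroup M -> nend f -> M x -> M (f x).
Proof. by move=> [_ _ _ Mf] [cf mf _]; exact: Mf. Qed.

End Nend.

Lemma closed_eq_group (X : topologicalType) (G : profiniteGroupType)
    (f g : X -> G) :
  continuous f -> continuous g -> closed [set x | f x = g x].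
Proof.
move=> cf cg.
have -> : [set x | f x = g x] = (fun x => f x / g x) @^-1` [set 1].
  by rewrite eqEsubset; split => x /= => [->|/divg1_eq]; rewrite ?mulgV.
apply: preimage_closed => [x _|].
  by apply: continuous_mulg => //; exact: continuous_invg.
exact/accessible_closed_set1/hausdorff_accessible/profinite_hausdorff.
Qed.

(** * Normal endomorphisms under pointwise convergence *)

Local Notation endo_space G := (prod_topology (fun _ : G => G)).

Section EndoSpace.
Variable G : profiniteGroupType.

Lemma endo_eval_continuous x : continuous (fun f : endo_space G => f x).
Proof. exact: (@proj_continuous G (fun=> G) x). Qed.

Lemma endo_compact : compact [set: endo_space G].
Proof. exact: profinite_compact. Qed.

Lemma endo_hausdorff : hausdorff_space (endo_space G).
Proof. exact: profinite_hausdorff. Qed.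

Lemma into_endo_continuous (X : topologicalType) (u : X -> endo_space G) :
  (forall i, continuous (fun x => u x i)) -> continuous u.
Proof.
move=> cu x; apply: (cvg_sup _ _ _).2 => i.
exact: (@continuous_comp_initial _ X G (fun f : endo_space G => f i) u (cu i) x).
Qed.

(** A pointwise limit of continuous maps may fail to be continuous, but preserving every
    [fi_subgroup] survives such limits. This lemma recovers continuity from it, by translating to
    [1]. *)
Lemma fi_preserving_continuous (f : G -> G) : fi_base G -> monoid_morphism f ->
  (forall M x, fi_subgroup M -> M x -> M (f x)) -> continuous f.
Proof.
move=> fiG mf fM x U Ufx.
have U1 : nbhs 1 [set z | U (f x * z)].
  apply: (@continuous_lmul G (f x) 1 U) => /=; by rewrite mulg1.
have [M fiM MU] := fiG _ U1.
have : nbhs x [set y | M (x^-1 * y)].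
  apply: (@continuous_lmul G x^-1 x M); rewrite /= mulVg.
  by apply: open_nbhs_nbhs; split; [exact: fi_open|exact: fi_one].
apply: filterS => y My /=.
have := MU _ (fM _ _ fiM My).
by rewrite /= mf.2 monoid_morphismV // mulVKg.
Qed.

Lemma nend_closed : fi_base G -> closed (@nend G : set (endo_space G)).
Proof.
move=> fiG.
have -> : (@nend G : set (endo_space G)) =
    [set f : endo_space G | f 1 = 1] `&`
    (\bigcap_(z : G * G) [set f : endo_space G | f (z.1 * z.2) = f z.1 * f z.2]) `&`
    (\bigcap_(z : G * G) [set f : endo_space G | f (z.1 ^ z.2) = f z.1 ^ z.2]) `&`
    (\bigcap_(M in @fi_subgroup G) \bigcap_(x in M) [set f : endo_space G | M (f x)]).
  rewrite eqEsubset; split => f.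
    move=> nf; split; last by move=> M fiM x Mx; exact: (fi_nend fiM nf Mx).
    split; last by move=> z _ /=; rewrite nendJ.
    by split => /=; [exact: nend1|move=> z _ /=; rewrite nendM].
  move=> [[[f1 fM] fJ] fi].
  have mf : monoid_morphism f by split => // x y; exact: (fM (x, y)).
  split => //; last by move=> x y; exact: (fJ (x, y)).
  by apply: fi_preserving_continuous => // M x fiM; exact: fi.
have ce := endo_eval_continuous.
repeat apply: closedI.
- apply: closed_eq_group ; [exact: ce|exact: continuous_const].
- apply: closed_bigI => -[x y] _; apply: closed_eq_group => //=.
  exact: continuous_mulg.
- apply: closed_bigI => -[x y] _; apply: closed_eq_group => //=.
  by apply: continuous_conjg => //; exact: continuous_const.
- apply: closed_bigI => M fiM; apply: closed_bigI => x _.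
  apply: (preimage_closed (f := fun f : endo_space G => f x)) => [z _|].
    exact: ce.
  exact: fi_closed.
Qed.

End EndoSpace.

(** * Idempotents in compact semigroups *)

Section EllisIdempotent.
Variables (X : topologicalType) (op : X -> X -> X).
Hypothesis opA : associative op.
Hypothesis cX : compact [set: X].
Hypothesis hX : hausdorff_space X.
Hypothesis op_continuous : forall y, continuous (op^~ y).

(* Ellis' argument: in a minimal nonempty closed subsemigroup M, both M s and
   {t in M | t s = s} are closed subsemigroups, hence equal to M. *)
Lemma ellis_idempotent (S : set X) :
  closed S -> S !=set0 -> (forall x y, S x -> S y -> S (op x y)) ->
  exists2 e, S e & op e e = e.
Proof.
move=> clS S0 Sop.
pose sg (A : set X) := [/\ A `<=` S, closed A, A !=set0 &
  forall x y, A x -> A y -> A (op x y)].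
pose T := {A | sg A}.
pose R (A B : T) := `[< sval B `<=` sval A >].
(* The order [R] is reverse inclusion, so Zorn's lemma returns a minimal subsemigroup. The
   intersection of a chain is nonempty by compactness. *)
have sgS : sg S by split.
have [||F Ftot|[M sgM] Mmin] := @ZL_preorder T (exist _ S sgS) R.
- by move=> A; apply/asboolP.
- by move=> A B C /asboolP AB /asboolP BC; apply/asboolP; exact: subset_trans AB.
- have [F0|F0] := pselect (F !=set0); last first.
    by exists (exist _ S sgS) => A FA; case: F0; exists A.
  have [A0 FA0] := F0.
  pose B := [set x | forall A : T, F A -> sval A x].
  have sgB : sg B.
    split.
    + by move=> x /(_ _ FA0); have [+ _ _ _] := svalP A0; exact.
    + have -> : B = \bigcap_(A in F) sval A by [].
      by apply: closed_bigI => A _; have [] := svalP A.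
    + pose K := {A | F A}.
      have [|||x Dx] := @directed_closed_nonempty X K (exist _ A0 FA0)
          (fun A => sval (sval A)) cX.
      * by move=> [A FA] /=; have [] := svalP A.
      * by move=> [A FA] /=; have [] := svalP A.
      * move=> [A FA] [A' FA']; have [/asboolP AA|/asboolP AA] := Ftot _ _ FA FA'.
          by exists (exist _ A' FA') => /= x A'x; split => //; exact: AA.
        by exists (exist _ A FA) => /= x Ax; split => //; exact: AA.
      * by exists x => A FA; exact: (Dx (exist _ A FA)).
    + move=> x y Bx By A FA; have [_ _ _] := svalP A.
      by apply; [exact: Bx|exact: By].
  by exists (exist _ B sgB) => A FA; apply/asboolP => x; exact.
have {}Mmin A : sg A -> A `<=` M -> M `<=` A.
  move=> sgA AM; have /asboolP := Mmin (exist _ A sgA) (asboolT AM).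
  by [].
have [MS clM [s Ms] Mop] := sgM.
have : sg [set op t s | t in M].
  split.
  + by move=> _ [t Mt <-]; apply: MS; exact: Mop.
  + apply: compact_closed => //; apply: continuous_compact.
      exact: continuous_subspaceT.
    exact: subclosed_compact cX _.
  + by exists (op s s); exists s.
  + move=> _ _ [t Mt <-] [u Mu <-]; exists (op (op t s) u); last by rewrite !opA.
    by apply: (Mop) => //; exact: Mop.
move=> /Mmin/(_ _)/(_ s Ms) [|t Mt tss].
  by move=> _ [t Mt <-]; exact: Mop.
have : sg ([set t | op t s = s] `&` M).
  split.
  + by move=> x [_ /MS].
  + apply: closedI => //.
    apply: (preimage_closed (f := op^~ s) (D := [set s])).
      by move=> x _; exact: op_continuous.
    exact/accessible_closed_set1/hausdorff_accessible.
  + by exists t.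
  + move=> x y [/= xs Mx] [/= ys My]; split; last exact: Mop.
    by rewrite /= -opA ys xs.
move=> /Mmin/(_ _)/(_ s Ms) [|ss _]; first by move=> x [].
by exists s => //; exact: MS.
Qed.

End EllisIdempotent.

(** * Primitive idempotents *)

Definition idem_nend (G : topologicalGroupType) (e : G -> G) :=
  nend e /\ forall x, e (e x) = e x.

(** The usual order of idempotents, [u = eu = ue]. It is stated for arbitrary maps because [corner]
    uses it for maps that are not idempotent. *)
Definition below (G : Type) (u e : G -> G) :=
  forall x, e (u x) = u x /\ u (e x) = u x.

Definition primitive (G : topologicalGroupType) (e : G -> G) :=
  [/\ idem_nend e, exists x, e x <> 1 &
    forall u, idem_nend u -> below u e -> (forall x, u x = 1) \/ (forall x, u x = e x)].

Section Complement.
Variables (G : topologicalGroupType) (e u : G -> G).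
Hypotheses (ide : idem_nend e) (idu : idem_nend u) (ue : below u e).

(** The noncommutative form of [e - u]: the projection onto the factor that complements the image of
    [u] inside the image of [e]. *)
Definition complement (x : G) : G := (u x)^-1 * e x.

(** Evaluate [u (w ^ z)] twice: normality gives [u w ^ z], multiplicativity gives [u w ^ u z], which
    is [u w]. So the image and the kernel of [u] centralize each other, which is what makes
    [complement] multiplicative. *)
Lemma idem_commute w z : u w = w -> u z = 1 -> w * z = z * w.
Proof.
move=> uw uz; have [nu _] := idu.
have wz : w ^ z = w.
  rewrite -{1}uw -nendJ// (monoid_morphismJ (nend_morphism nu)) uz conjg1.
  exact: uw.
by rewrite -{2}wz -conjgC.
Qed.

Lemma below_complement x : u (complement x) = 1.
Proof.
have [nu uu] := idu.
by rewrite /complement nendM// nendV// uu (ue x).2 mulVg.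
Qed.

Lemma complement_below x : complement (u x) = 1.
Proof. by rewrite /complement (ue x).1 (idu.2 x) mulVg. Qed.

Lemma mul_complement x : u x * complement x = e x.
Proof. by rewrite /complement mulVKg. Qed.

Lemma below_complementP : below complement e.
Proof.
move=> x; rewrite /complement; split; last by rewrite (ue x).2 ide.2.
by rewrite (nendM ide.1) (nendV _ ide.1) (ue x).1 ide.2.
Qed.

Lemma complement_idem : idem_nend complement.
Proof.
have [[nu uu] [ne ee]] := (idu, ide).
split; last first.
  move=> x; rewrite -[LHS]/((u (complement x))^-1 * e (complement x)).
  by rewrite below_complement invg1 mul1g (below_complementP x).1.
split.
- by apply: continuous_mulg; [apply: continuous_invg|]; exact: nend_continuous.
- split => [|x y]; first by rewrite /complement (nend1 nu) (nend1 ne) invg1 mulg1.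
  have C : u y * complement x = complement x * u y.
    by apply: idem_commute; [rewrite uu|exact: below_complement].
  have -> : complement (x * y) = (u y)^-1 * (complement x * e y).
    by rewrite /complement (nendM nu) (nendM ne) invgM !mulgA.
  apply: (mulgI (u y)).
  by rewrite mulVKg -(mul_complement y) [LHS]mulgA -C -[LHS]mulgA.
- by move=> x y; rewrite /complement (nendJ _ _ nu) (nendJ _ _ ne) conjMg conjVg.
Qed.

End Complement.

Section ExistsPrimitive.
Variables (G : profiniteGroupType) (M : set G) (r : G -> G).
Hypotheses (fiG : fi_base G) (fiM : fi_subgroup M) (idr : idem_nend r).

Let admissible (e : G -> G) :=
  [/\ idem_nend e, below e r & exists x, ~ M (e x)].

(** Compactness is used twice. In [G] it yields a point [y] outside [M] fixed by the whole chain. In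
    the space of normal endomorphisms it yields [f] whose values are fixed by the chain and which
    fixes every common fixed point; such an [f] is idempotent and keeps [y] outside [M]. *)
Let chain_bound (F : set (G -> G)) (e0 : G -> G) : F e0 ->
  (forall e, F e -> admissible e) ->
  (forall e e', F e -> F e' ->
    (forall x, e (e' x) = e' x) \/ (forall x, e' (e x) = e x)) ->
  exists2 f, admissible f & forall e, F e -> forall x, e (f x) = f x.
Proof.
move=> Fe0 Fadm Ftot; pose K := {e | F e}; pose k0 : K := exist _ e0 Fe0.
have [|||y yF] := @directed_closed_nonempty G K k0
    (fun e => [set y | sval e y = y] `&` ~` M) (@profinite_compact G).
- move=> [e Fe] /=; have [[ne _] _ _] := Fadm _ Fe.
  apply: closedI; last by apply: open_closedC; exact: fi_open.
  by apply: closed_eq_group => [|x]; [exact: nend_continuous|exact: cvg_id].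
- move=> [e Fe] /=; have [[_ ee] _ [x Mx]] := Fadm _ Fe.
  by exists (e x); split => //=; exact: ee.
- move=> [e Fe] [e' Fe'] /=; have [ee|ee] := Ftot _ _ Fe Fe'.
    by exists (exist _ e' Fe') => /= x [ex Mx]; split; split => //=; rewrite -ex ee.
  by exists (exist _ e Fe) => /= x [ex Mx]; split; split => //=; rewrite -ex ee.
pose Z := [set y | forall e, F e -> e y = y].
pose D (e : K) : set (endo_space G) := (@nend G : set (endo_space G)) `&`
  (\bigcap_x [set f : endo_space G | sval e (f x) = f x]) `&`
  (\bigcap_x [set f : endo_space G | r (f x) = f x]) `&`
  (\bigcap_x [set f : endo_space G | f (r x) = f x]) `&`
  (\bigcap_(z in Z) [set f : endo_space G | f z = z]).
(* Each [D e] contains [e] itself. The family is directed because the images of the chain are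
   nested. *)
have [|||f fD] := @directed_closed_nonempty (endo_space G) K k0 D (@endo_compact G).
- move=> [e Fe]; have [[ne _] _ _] := Fadm _ Fe.
  have cc (g : G -> G) : nend g -> forall x, continuous (fun f : endo_space G => g (f x)).
    move=> ng x; apply: (continuous_compf (f := fun f : endo_space G => f x)).
      exact: endo_eval_continuous.
    exact: nend_continuous.
  repeat apply: closedI; first exact: nend_closed.
  + apply: closed_bigI => x _; apply: closed_eq_group; first exact: cc.
    exact: endo_eval_continuous.
  + apply: closed_bigI => x _; apply: closed_eq_group; first exact: cc idr.1 _.
    exact: endo_eval_continuous.
  + by apply: closed_bigI => x _; apply: closed_eq_group; exact: endo_eval_continuous.
  + apply: closed_bigI => x _; apply: closed_eq_group; first exact: endo_eval_continuous.
    exact: continuous_const.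
- move=> [e Fe]; have [[ne ee] er _] := Fadm _ Fe.
  exists e; rewrite /D /=; repeat split => //.
  + by move=> x _ /=; rewrite ee.
  + by move=> x _ /=; rewrite (er x).1.
  + by move=> x _ /=; rewrite (er x).2.
  + by move=> z Zz; exact: Zz.
- move=> [e Fe] [e' Fe'] /=; have [ee|ee] := Ftot _ _ Fe Fe'.
    exists (exist _ e' Fe') => /= f [[[[nf fe] fr] fr'] fZ]; split; split => //; split => //; split => //; split => //.
    by move=> x _ /=; have /= <- := fe x I; rewrite ee.
  exists (exist _ e Fe) => /= f [[[[nf fe] fr] fr'] fZ]; split; split => //; split => //; split => //; split => //.
  by move=> x _ /=; have /= <- := fe x I; rewrite ee.
have ef e (Fe : F e) x : e (f x) = f x.
  by have [[[[_ +] _] _] _] := fD (exist _ e Fe) => /(_ x I).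
have [[[[nf _] rf] fr] fZ] := fD k0.
exists f => //; split.
- by split => // x; apply: fZ => e Fe; exact: ef.
- by move=> x; split; [exact: rf|exact: fr].
- exists y; rewrite fZ; first by have [_] := yF k0.
  by move=> e Fe; have [] := yF (exist _ e Fe).
Qed.

(** Zorn's lemma gives an admissible [e] with minimal image. An idempotent [u] below [e] that does
    not map into [M] has the same image, hence equals [e]. If [u] maps into [M], its complement does
    not; by minimality the complement fixes the image of [e], and applying [u] shows that [u] is
    trivial. *)
Lemma exists_primitive : (exists x, ~ M (r x)) ->
  exists e, [/\ primitive e, below e r & exists x, ~ M (e x)].
Proof.
move=> rM; pose T := {e | admissible e}.
(* This compares images only, hence is just a preorder: idempotents with the same image may
   differ. *)
pose R (e e' : T) := `[< forall x, sval e (sval e' x) = sval e' x >].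
have admr : admissible r by split => // x; rewrite idr.2.
have [||F Ftot|[e adme] emin] := @ZL_preorder T (exist _ r admr) R.
- by move=> e; have [[_ ee] _ _] := svalP e; apply/asboolP.
- move=> e f g /asboolP ef /asboolP fg; apply/asboolP => x.
  by rewrite -fg ef.
- have [[[e0 ad0] Fe0]|F0] := pselect (F !=set0); last first.
    by exists (exist _ r admr) => A FA; case: F0; exists A.
  have [|||f admf fF] := @chain_bound [set e | exists ad, F (exist _ e ad)] e0.
  + by exists ad0.
  + by move=> e [].
  + move=> e e' [ad Fe] [ad' Fe'].
    by have [/asboolP|/asboolP] := Ftot _ _ Fe Fe'; [left|right].
  + exists (exist _ f admf) => -[e ade] Fe; apply/asboolP => x /=.
    by apply: fF; exists ade.
have {}emin u : admissible u -> (forall x, e (u x) = u x) -> forall x, u (e x) = e x.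
  by move=> admu eu; have /asboolP := emin (exist _ u admu) (asboolT eu).
have [ide er [x0 Mx0]] := adme.
exists e; split => //; last by exists x0.
split => //.
  by exists x0 => ex0; apply: Mx0; rewrite ex0; exact: fi_one.
have belowr u : below u e -> below u r.
  move=> ue x; split; first by rewrite -(ue x).1 (er _).1.
  by rewrite -[in LHS](ue (r x)).2 (er x).2 (ue x).2.
move=> u idu ue; have [uM|uM] := pselect (exists x, ~ M (u x)).
  right => x; rewrite -(ue x).2; apply: emin => [|z]; last by rewrite (ue z).1.
  by split => //; exact: belowr.
left => x.
have idc := complement_idem ide idu ue.
have bc := below_complementP ide ue.
have cM : exists x, ~ M (complement e u x).
  exists x0 => cM; apply: Mx0; rewrite -(mul_complement e u).
  by apply: fi_mul => //; apply: contrapT => Mu; apply: uM; exists x0.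
have := emin _ (And3 idc (belowr _ bc) cM) (fun x => (bc x).1) x.
move=> /(congr1 u); by rewrite below_complement// (ue x).2 => <-.
Qed.

End ExistsPrimitive.

(** * Direct factors as profinite groups *)

Section FixGroup.
Variables (G : profiniteGroupType) (e : G -> G).
Hypothesis ide : idem_nend e.

Let val_fix : {x : G | e x == x} -> G := val.

(** The image of [e] with the topology induced from [G]. The [let] makes the type depend on the
    proof [ide], from which the group structure on it is built. *)
Definition fix_group : Type := let _ := ide in initial_topology val_fix.

HB.instance Definition _ := Topological.copy fix_group (initial_topology val_fix).

Definition fix_val (x : fix_group) : G := val_fix x.

Lemma fix_valP x : e (fix_val x) = fix_val x.
Proof. exact/eqP/(svalP (x : {x : G | e x == x})). Qed.

Lemma fix_val_inj : injective fix_val. Proof. exact: val_inj. Qed.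

Lemma fix_retract_subproof x : e (e x) == e x.
Proof. by apply/eqP; exact: ide.2. Qed.

Definition fix_retract (x : G) : fix_group := exist _ (e x) (fix_retract_subproof x).

Lemma fix_retractK x : fix_val (fix_retract x) = e x. Proof. by []. Qed.

Lemma fix_valK : cancel fix_val fix_retract.
Proof. by move=> x; apply: fix_val_inj; rewrite fix_retractK fix_valP. Qed.

Lemma fix_val_continuous : continuous fix_val.
Proof. exact: initial_continuous. Qed.

Lemma into_fix_continuous (X : topologicalType) (u : X -> fix_group) :
  continuous (fun x => fix_val (u x)) -> continuous u.
Proof.
by move=> cu x; exact: (@continuous_comp_initial _ X G val_fix u cu x).
Qed.

Lemma fix_retract_continuous : continuous fix_retract.
Proof. by apply: into_fix_continuous; exact: nend_continuous ide.1. Qed.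

(** The operations are those of [G] followed by the retraction, so membership comes for free;
    [val_one], [val_inv] and [val_mul] show that the retraction changes nothing. *)
Let one : fix_group := fix_retract 1.
Let inv x : fix_group := fix_retract (fix_val x)^-1.
Let mul x y : fix_group := fix_retract (fix_val x * fix_val y).

Let val_one : fix_val one = 1. Proof. exact: nend1 ide.1. Qed.

Let val_inv x : fix_val (inv x) = (fix_val x)^-1.
Proof. by rewrite fix_retractK (nendV _ ide.1) fix_valP. Qed.

Let val_mul x y : fix_val (mul x y) = fix_val x * fix_val y.
Proof. by rewrite fix_retractK (nendM ide.1) !fix_valP. Qed.

Let mulA : associative mul.
Proof. by move=> x y z; apply: fix_val_inj; rewrite !val_mul mulgA. Qed.

Let mul1 : left_id one mul.
Proof. by move=> x; apply: fix_val_inj; rewrite val_mul val_one mul1g. Qed.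

Let mulr1 : right_id one mul.
Proof. by move=> x; apply: fix_val_inj; rewrite val_mul val_one mulg1. Qed.

Let mulV : left_inverse one inv mul.
Proof. by move=> x; apply: fix_val_inj; rewrite val_mul val_inv val_one mulVg. Qed.

Let mulrV : right_inverse one inv mul.
Proof. by move=> x; apply: fix_val_inj; rewrite val_mul val_inv val_one mulgV. Qed.

HB.instance Definition _ := isGroup.Build fix_group mulA mul1 mulr1 mulV mulrV.

Let fix_mulg_continuous : continuous (fun x : fix_group * fix_group => x.1 * x.2).
Proof.
apply: into_fix_continuous.
have -> : (fun x : fix_group * fix_group => fix_val (x.1 * x.2)) =
          (fun x => fix_val x.1 * fix_val x.2).
  by apply/funext => x; exact: val_mul.
apply: continuous_mulg.
- apply: (continuous_compf (f := fst)); last exact: fix_val_continuous.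
  by move=> x; exact: cvg_fst.
- apply: (continuous_compf (f := snd)); last exact: fix_val_continuous.
  by move=> x; exact: cvg_snd.
Qed.

Let fix_invg_continuous : continuous (fun x : fix_group => x^-1).
Proof.
apply: into_fix_continuous.
have -> : (fun x : fix_group => fix_val x^-1) = (fun x => (fix_val x)^-1).
  by apply/funext => x; exact: val_inv.
exact/continuous_invg/fix_val_continuous.
Qed.

HB.instance Definition _ := PreTopologicalGroup_isTopologicalGroup.Build
  fix_group fix_mulg_continuous fix_invg_continuous.

Let fix_compact : compact [set: fix_group].
Proof.
have -> : [set: fix_group] = fix_retract @` [set: G].
  by rewrite eqEsubset; split => // x _; exists (fix_val x) => //; exact: fix_valK.
apply: continuous_compact; last exact: profinite_compact.
exact/continuous_subspaceT/fix_retract_continuous.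
Qed.

Let fix_hausdorff : hausdorff_space fix_group.
Proof.
move=> x y xy; apply: fix_val_inj; apply: profinite_hausdorff => U V Ux Vy.
have [z [Uz Vz]] := xy _ _ (fix_val_continuous Ux) (fix_val_continuous Vy).
by exists (fix_val z).
Qed.

Let fix_totally_disconnected : totally_disconnected [set: fix_group].
Proof.
move=> x _; rewrite eqEsubset; split; last first.
  by move=> _ ->; exact: connected_component_refl.
move=> y [D [Dx _ cD] Dy]; apply: fix_val_inj.
suff : connected_component [set: G] (fix_val x) (fix_val y).
  by rewrite profinite_totally_disconnected.
exists (fix_val @` D); last by exists y.
split; [by exists x| by [] |].
apply: connected_continuous_connected => //.
exact/continuous_subspaceT/fix_val_continuous.
Qed.

HB.instance Definition _ := TopologicalGroup_isProfinite.Build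
  fix_group fix_compact fix_hausdorff fix_totally_disconnected.

Lemma fix_val_morphism : monoid_morphism fix_val.
Proof. by split; [exact: val_one|exact: val_mul]. Qed.

Lemma fix_retract_morphism : monoid_morphism fix_retract.
Proof.
split => [|x y]; first by apply: fix_val_inj.
apply: fix_val_inj.
by rewrite (monoid_morphismM fix_val_morphism) !fix_retractK (nendM ide.1).
Qed.

End FixGroup.

(** * Isomorphisms, normal retracts and indecomposability *)

Lemma cancel_morphism (G H : groupType) (f : G -> H) (g : H -> G) :
  monoid_morphism f -> cancel f g -> cancel g f -> monoid_morphism g.
Proof.
move=> [f1 fM] fK gK; split => [|x y]; first by rewrite -f1 fK.
by rewrite -{1}[x]gK -{1}[y]gK -fM fK.
Qed.

Lemma isomorphic_refl (G : topologicalGroupType) : isomorphic G G.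
Proof. by exists id, id; split => // x; exact: cvg_id. Qed.

Lemma isomorphic_sym (G H : topologicalGroupType) : isomorphic G H -> isomorphic H G.
Proof.
move=> [f [g [mf cf cg fK gK]]]; exists g, f; split => //.
exact: cancel_morphism mf fK gK.
Qed.

Lemma isomorphic_trans (G H K : topologicalGroupType) :
  isomorphic G H -> isomorphic H K -> isomorphic G K.
Proof.
move=> [f [g [mf cf cg fK gK]]] [f' [g' [mf' cf' cg' fK' gK']]].
exists (fun x => f' (f x)), (fun x => g (g' x)); split.
- exact: monoid_morphism_comp.
- exact: continuous_compf.
- exact: continuous_compf.
- by move=> x; rewrite fK' fK.
- by move=> x; rewrite gK gK'.
Qed.

Lemma bijective_isomorphic (G H : profiniteGroupType) (f : G -> H) :
  continuous f -> monoid_morphism f -> (forall x, f x = 1 -> x = 1) ->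
  (forall y, exists x, f x = y) -> isomorphic G H.
Proof.
move=> cf mf f1 fsurj.
have /choice[g gK] : forall y, exists x, f x = y by [].
have fI := monoid_morphism_inj mf f1.
have fK : cancel f g by move=> x; apply: fI; exact: gK.
exists f, g; split => //.
apply: (@continuous_bij_inverse G H f g) => //; first exact: profinite_compact.
exact: profinite_hausdorff.
Qed.

(** A direct factor given by an inclusion and a projection, so that coordinates of a product and
    fixed groups of idempotents are treated alike. *)
Definition normal_retract (G F : topologicalGroupType) (i : F -> G) (p : G -> F) :=
  [/\ continuous i, monoid_morphism i, continuous p, monoid_morphism p &
    cancel i p /\ nend (fun x => i (p x))].

Section NormalRetract.
Variables (G F : profiniteGroupType) (i : F -> G) (p : G -> F).
Hypothesis ip : normal_retract i p.

Let ci : continuous i. Proof. by case: ip. Qed.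
Let mi : monoid_morphism i. Proof. by case: ip. Qed.
Let cp : continuous p. Proof. by case: ip. Qed.
Let mp : monoid_morphism p. Proof. by case: ip. Qed.
Let iK : cancel i p. Proof. by case: ip => ? ? ? ? []. Qed.
Let nip : nend (fun x => i (p x)). Proof. by case: ip => ? ? ? ? []. Qed.

Lemma retract_idem : idem_nend (fun x => i (p x)).
Proof. by split => // x; rewrite iK. Qed.

(** Because [i \o p] is normal and fixes the image of [i], conjugating an element of that image by
    [y] or by [i (p y)] gives the same result. *)
Lemma push_nend u : nend u -> nend (fun x => i (u (p x))).
Proof.
move=> nu; split.
- apply: (continuous_compf (f := fun x => u (p x))) => //.
  by apply: continuous_compf => //; exact: nend_continuous.
- apply: (monoid_morphism_comp (f := fun x => u (p x))) => //.
  by apply: monoid_morphism_comp => //; exact: nend_morphism.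
- move=> x y; rewrite (monoid_morphismJ mp) (nendJ _ _ nu).
  have E z : i (p (i (u z) ^ y)) = i (u z) ^ y.
    by rewrite (nendJ (i (u z)) y nip) iK.
  by rewrite -E (monoid_morphismJ mp) iK.
Qed.

Lemma pull_nend v : nend v -> nend (fun a => p (v (i a))).
Proof.
move=> nv; split.
- apply: (continuous_compf (f := fun x => v (i x))) => //.
  by apply: continuous_compf => //; exact: nend_continuous.
- apply: (monoid_morphism_comp (f := fun x => v (i x))) => //.
  by apply: monoid_morphism_comp => //; exact: nend_morphism.
- by move=> a b; rewrite (monoid_morphismJ mi) (nendJ _ _ nv) (monoid_morphismJ mp) iK.
Qed.

End NormalRetract.

Section Indecomposable.
Variable F : profiniteGroupType.

(** An idempotent normal [u] splits [F] as the product of its image and the image of its complement,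
    so one of the two is trivial. *)
Lemma indecomposable_idem : indecomposable F ->
  forall u : F -> F, idem_nend u -> (forall x, u x = 1) \/ (forall x, u x = x).
Proof.
move=> indF u idu.
have id1 : idem_nend (@id F) by split => //; exact: nend_id.
have u1 : below u id by [].
have idv := complement_idem id1 idu u1.
set v := complement id u in idv.
have vu x : v (u x) = 1 by exact: complement_below.
have uv x : u (v x) = 1 by exact: below_complement.
have uvx x : u x * v x = x by exact: mul_complement.
have [] := indF (fix_group idu) (fix_group idv).
- exists (fun x => (fix_retract idu x, fix_retract idv x)).
  exists (fun y => fix_val y.1 * fix_val y.2); split.
  + have [u1' uM] := fix_retract_morphism idu; have [v1' vM] := fix_retract_morphism idv.
    by split => [|x y]; rewrite ?u1' ?v1' ?uM ?vM.
  + by apply: continuous_pair; exact: fix_retract_continuous.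
  + apply: continuous_mulg.
      apply: (continuous_compf (f := fst) (g := @fix_val _ _ idu)) => [x|].
        exact: cvg_fst.
      exact: fix_val_continuous.
    apply: (continuous_compf (f := snd) (g := @fix_val _ _ idv)) => [x|].
      exact: cvg_snd.
    exact: fix_val_continuous.
  + by move=> x /=; rewrite !fix_retractK uvx.
  + move=> [a b] /=; congr pair; apply: fix_val_inj; rewrite fix_retractK.
      by rewrite (nendM idu.1) -(fix_valP b) uv mulg1 fix_valP.
    by rewrite (nendM idv.1) -(fix_valP a) vu mul1g fix_valP.
- move=> A1; left => x.
  have := fix_retractK idu x; rewrite (A1 (fix_retract idu x)) => <-.
  exact: monoid_morphism1 (fix_val_morphism _).
- move=> B1; right => x; rewrite -[RHS]uvx.
  have := fix_retractK idv x; rewrite (B1 (fix_retract idv x)) => <-.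
  by rewrite (monoid_morphism1 (fix_val_morphism _)) mulg1.
Qed.

(** Given [F] as a product of [A] and [B], the projection onto [A], seen as an endomorphism of [F],
    is idempotent and normal. *)
Lemma idem_indecomposable :
  (forall u : F -> F, idem_nend u -> (forall x, u x = 1) \/ (forall x, u x = x)) ->
  indecomposable F.
Proof.
move=> Fidem A B [f [g [mf cf cg fK gK]]].
have mg := cancel_morphism mf fK gK.
pose u x := g ((f x).1, 1).
have idu : idem_nend u.
  split; last by move=> x; rewrite /u gK.
  split.
  - apply: (continuous_compf (f := fun x => ((f x).1, 1))) => //.
    apply: continuous_pair; last exact: continuous_const.
    by apply: (continuous_compf (f := f) (g := fst)) => // y; exact: cvg_fst.
  - split => [|x y]; first by rewrite /u mf.1 -[RHS]mg.1.
    rewrite /u mf.2 -mg.2; congr g.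
    by rewrite -[RHS]/((f x).1 * (f y).1, 1 * 1) mulg1.
  - move=> x y; rewrite /u (monoid_morphismJ mf) -[y in RHS]fK -(monoid_morphismJ mg).
    congr g; rewrite -[RHS]/((f x).1 ^ (f y).1, 1 ^ (f y).2).
    by rewrite conj1g.
have [u1|uid] := Fidem _ idu; [left => a|right => b].
  have := u1 (g (a, 1)); rewrite /u gK /= => /(congr1 f).
  by rewrite gK mf.1 => -[].
have := uid (g (1, b)); rewrite /u gK /= => /(congr1 f).
by rewrite !gK => -[].
Qed.

End Indecomposable.

(** Translates between indecomposable factors and primitive idempotents: [push_nend] and [pull_nend]
    match the idempotents of [F] with those of [G] below [i \o p]. *)
Lemma primitive_retract (G F : profiniteGroupType) (i : F -> G) (p : G -> F) :
  normal_retract i p ->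
  primitive (fun x => i (p x)) <-> ~ trivial_group F /\ indecomposable F.
Proof.
move=> ip; have [ci mi cp mp [iK nip]] := ip; split.
- move=> [_ [x0 x01] prim]; split.
    by move=> F1; apply: x01; rewrite (F1 (p x0)) mi.1.
  apply: idem_indecomposable => u [nu uu].
  have idw : idem_nend (fun x => i (u (p x))).
    by split; [exact: (push_nend ip nu)|move=> x; rewrite iK uu].
  have [|w1|wip] := prim _ idw; first by move=> x; rewrite !iK.
    by left => a; have := w1 (i a); rewrite iK => /(congr1 p); rewrite iK mp.1.
  by right => a; have := wip (i a); rewrite iK => /(congr1 p); rewrite !iK.
- move=> [F1 indF]; split; first exact: (retract_idem ip).
    apply: contrapT => ip1; apply: F1 => a; apply: contrapT => a1; apply: ip1.
    by exists (i a); rewrite iK => /(congr1 p); rewrite iK mp.1.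
  move=> u [nu uu] ub.
  have idw : idem_nend (fun a => p (u (i a))).
    by split; [exact: (pull_nend ip nu)|move=> a; rewrite (ub _).1 uu].
  have [w1|wid] := indecomposable_idem indF idw; [left => x|right => x].
    by rewrite -(ub x).2 -(ub _).1 w1 mi.1.
  by rewrite -(ub x).2 -(ub _).1 wid.
Qed.

Lemma fix_normal_retract (G : profiniteGroupType) (e : G -> G) (ide : idem_nend e) :
  normal_retract (@fix_val _ _ ide) (fix_retract ide).
Proof.
split; [exact: fix_val_continuous|exact: fix_val_morphism|
  exact: fix_retract_continuous|exact: fix_retract_morphism|].
by split; [exact: fix_valK|exact: ide.1].
Qed.

(** An endomorphism [f] of [F] extends to the endomorphism [i \o f \o p] of [G], so the preimage
    under [i] of a fully invariant subgroup is fully invariant. *)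
Lemma fi_base_retract (G F : profiniteGroupType) (i : F -> G) (p : G -> F) :
  continuous i -> monoid_morphism i -> continuous p -> monoid_morphism p ->
  cancel i p -> fi_base G -> fi_base F.
Proof.
move=> ci mi cp mp iK fiG U U1.
have pU1 : nbhs 1 (p @^-1` U) by apply: cp; rewrite mp.1.
have [M fiM MU] := fiG _ pU1.
exists (i @^-1` M); last by move=> a /MU /=; rewrite iK.
split.
- by apply: open_comp (fi_open fiM) => x _; exact: ci.
- by rewrite /= mi.1; exact: fi_one.
- by move=> a b /=; rewrite mi.2 (monoid_morphismV mi); exact: fi_div.
- move=> f cf mf a /= Ma; have [_ _ _ Mf] := fiM.
  have -> : f a = f (p (i a)) by rewrite iK.
  apply: (Mf (fun x => i (f (p x)))) => //.
    apply: (continuous_compf (f := fun x => f (p x))) => //.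
    exact: continuous_compf.
  apply: (monoid_morphism_comp (f := fun x => f (p x))) => //.
  exact: monoid_morphism_comp.
Qed.

(** * Projections of a direct product *)

Lemma into_prod_continuous (I : Type) (T : I -> topologicalType)
    (X : topologicalType) (u : X -> prod_topology T) :
  (forall i, continuous (fun x => u x i)) -> continuous u.
Proof.
move=> cu x; apply: (cvg_sup _ _ _).2 => i.
exact: (@continuous_comp_initial _ X (T i) (fun f : prod_topology T => f i) u (cu i) x).
Qed.

Lemma coord_continuous (I : Type) (T : I -> topologicalType) (i : I) :
  continuous (fun f : prod_topology T => f i).
Proof. exact: (@proj_continuous {classic I} T i). Qed.

Section ProductMaps.
Variables (I : Type) (F : I -> profiniteGroupType).
Notation P := (prod_topology F).

Definition restr (S : set I) (x : P) : P := fun i => if `[< S i >] then x i else 1.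

Lemma restr_nend S : nend (restr S).
Proof.
split.
- apply: into_prod_continuous => i; rewrite /restr.
  by case: asboolP => _; [exact: coord_continuous|exact: continuous_const].
- split => [|x y]; apply: functional_extensionality_dep => i; rewrite /restr.
    by case: asboolP.
  rewrite -[RHS]/((if `[< S i >] then x i else 1) * (if `[< S i >] then y i else 1)).
  by case: asboolP => // _; rewrite mulg1.
- move=> x y; apply: functional_extensionality_dep => i; rewrite /restr.
  rewrite -[RHS]/((if `[< S i >] then x i else 1) ^ (y i)).
  by case: asboolP => // _; rewrite conj1g.
Qed.

Definition single (i : I) (a : F i) : P :=
  fun j => if pselect (i = j) is left ij then eq_rect i (fun k => F k : Type) a j ij else 1.

Lemma single_eq i (a : F i) : single a i = a.
Proof.
rewrite /single; case: pselect => // ii.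
by rewrite (Prop_irrelevance ii erefl).
Qed.

Lemma single_neq i j (a : F i) : i <> j -> single a j = 1.
Proof. by rewrite /single; case: pselect. Qed.

Lemma single_continuous i : continuous (@single i).
Proof.
apply: into_prod_continuous => j; rewrite /single; case: pselect => [ij|_].
  by case: _ / ij => x; exact: cvg_id.
exact: continuous_const.
Qed.

Lemma single_morphism i : monoid_morphism (@single i).
Proof.
split => [|a b]; apply: functional_extensionality_dep => j.
  by rewrite /single; case: pselect => // ij; case: _ / ij.
rewrite -[RHS]/(single a j * single b j) /single.
by case: pselect => [ij|_]; [case: _ / ij|rewrite mulg1].
Qed.

Definition omit (i : I) : Type := {k | k <> i}.

Notation Pomit i := (prod_topology (fun k : omit i => F (sval k))).

Definition extend (i : I) (d : Pomit i) : P :=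
  fun k => if pselect (k <> i) is left ki then d (exist _ k ki) else 1.

Lemma extend_eq i (d : Pomit i) : extend d i = 1.
Proof. by rewrite /extend; case: pselect. Qed.

Lemma extend_neq i (d : Pomit i) (k : omit i) : extend d (sval k) = d k.
Proof.
case: k => k ki; rewrite /extend; case: pselect => //= ki'.
by rewrite (Prop_irrelevance ki' ki).
Qed.

Lemma extend_continuous i : continuous (@extend i).
Proof.
apply: into_prod_continuous => k; rewrite /extend; case: pselect => ki.
  exact (@coord_continuous _ (fun k : omit i => F (sval k) : topologicalType) (exist _ k ki)).
exact: continuous_const.
Qed.

Lemma extend_morphism i : monoid_morphism (@extend i).
Proof.
split => [|a b]; apply: functional_extensionality_dep => k.
  by rewrite /extend; case: pselect.
rewrite -[RHS]/(extend a k * extend b k) /extend.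
by case: pselect => // _; rewrite mulg1.
Qed.

Definition forget (i : I) (x : P) : Pomit i := fun k => x (sval k).

Lemma forget_continuous i : continuous (@forget i).
Proof.
apply: (into_prod_continuous (T := fun k : omit i => F (sval k))) => k.
exact: coord_continuous.
Qed.

Lemma forget_morphism i : monoid_morphism (@forget i).
Proof. by split. Qed.

Lemma extendK i : cancel (@extend i) (@forget i).
Proof.
by move=> d; apply: functional_extensionality_dep => k; exact: extend_neq.
Qed.

End ProductMaps.

Section Projections.
Variables (G : profiniteGroupType) (I : Type) (F : I -> profiniteGroupType).
Variables (f : G -> prod_topology F) (g : prod_topology F -> G).
Hypotheses (mf : monoid_morphism f) (cf : continuous f) (cg : continuous g).
Hypotheses (fK : cancel f g) (gK : cancel g f).

Let mg : monoid_morphism g. Proof. exact: cancel_morphism mf fK gK. Qed.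

Definition proj (S : set I) (x : G) : G := g (restr S (f x)).

Lemma proj_nend S : nend (proj S).
Proof.
have nr := restr_nend F S; split.
- apply: (continuous_compf (f := fun x => restr S (f x))) => //.
  by apply: continuous_compf => //; exact: nend_continuous.
- apply: (monoid_morphism_comp (f := fun x => restr S (f x))) => //.
  by apply: monoid_morphism_comp => //; exact: nend_morphism.
- move=> x y; rewrite /proj (monoid_morphismJ mf) (nendJ _ _ nr).
  by rewrite (monoid_morphismJ mg) fK.
Qed.

Lemma proj_coord S x i : f (proj S x) i = if `[< S i >] then f x i else 1.
Proof. by rewrite /proj gK. Qed.

Lemma coord_inj x y : (forall i, f x i = f y i) -> x = y.
Proof.
move=> xy; rewrite -[x]fK -[y]fK; congr g.
exact: functional_extensionality_dep.
Qed.

Lemma proj_setT x : proj setT x = x.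
Proof. by apply: coord_inj => i; rewrite proj_coord asboolT. Qed.

Lemma coordM x y i : f (x * y) i = f x i * f y i.
Proof. by rewrite mf.2. Qed.

Lemma coord1 i : f 1 i = 1.
Proof. by rewrite mf.1. Qed.

Lemma proj_split S i x : S i -> proj S x = proj [set i] x * proj (S `\ i) x.
Proof.
move=> Si; apply: coord_inj => k; rewrite coordM !proj_coord.
have [->|ki] := pselect (k = i).
  rewrite (@asboolT (S i))// (@asboolT ([set i] i))// (@asboolF ((S `\ i) i)) ?mulg1//.
  by case=> _; apply.
rewrite (@asboolF ([set i] k))// mul1g.
have [Sk|Sk] := pselect (S k); [rewrite !asboolT//|rewrite !asboolF//].
by case.
Qed.

Lemma proj_idem S : idem_nend (proj S).
Proof.
split; first exact: proj_nend.
by move=> x; apply: coord_inj => i; rewrite !proj_coord; case: asboolP.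
Qed.

Definition coord_incl i (a : F i) : G := g (single a).

Lemma coord_inclK i : cancel (@coord_incl i) (fun x => f x i).
Proof. by move=> a; rewrite /coord_incl gK single_eq. Qed.

Lemma coord_inclE i x : coord_incl (f x i) = proj [set i] x.
Proof.
apply: coord_inj => k; rewrite proj_coord gK.
case: asboolP => [->|ki]; first by rewrite single_eq.
by rewrite single_neq// => ik; apply: ki.
Qed.

Lemma coord_retract i : normal_retract (@coord_incl i) (fun x => f x i).
Proof.
split.
- by apply: continuous_compf => //; exact: single_continuous.
- by apply: monoid_morphism_comp => //; exact: single_morphism.
- by apply: (continuous_compf (f := f) (g := fun y : prod_topology F => y i)) => //; exact: coord_continuous.
- by split => [|x y]; [exact: coord1|exact: coordM].
- split; first exact: coord_inclK.
  have -> : (fun x => coord_incl (f x i)) = proj [set i].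
    by apply/funext => x; exact: coord_inclE.
  exact: proj_nend.
Qed.

Lemma proj_primitive i : ~ trivial_group (F i) -> indecomposable (F i) ->
  primitive (proj [set i]).
Proof.
move=> Fi1 indFi.
have <- : (fun x => coord_incl (f x i)) = proj [set i].
  by apply/funext => x; exact: coord_inclE.
by apply/(primitive_retract (coord_retract i)).2.
Qed.

(** Otherwise the closed sets of points outside [M] with trivial coordinates on a finite list would
    all be nonempty. A common point would have only trivial coordinates, yet lie outside [M]. *)
Lemma finite_support (M : set G) : open M -> M 1 ->
  exists s : seq {classic I}, forall x, (forall i, i \in s -> f x i = 1) -> M x.
Proof.
move=> oM M1; apply: contrapT => nM.
pose D (s : seq {classic I}) := ~` M `&` \bigcap_(i in [set` s]) [set x | f x i = 1].
have [|||x Dx] := @directed_closed_nonempty G _ [::] D (@profinite_compact G).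
- move=> s; apply: closedI; first exact: open_closedC.
  apply: closed_bigI => i _; apply: closed_eq_group; last exact: continuous_const.
  by apply: (continuous_compf (f := f) (g := fun y : prod_topology F => y i)) => //; exact: coord_continuous.
- move=> s; apply: contrapT => Ds; apply: nM; exists s => x sx.
  by apply: contrapT => Mx; apply: Ds; exists x; split.
- move=> s t; exists (s ++ t) => x [Mx Dx]; split; split => // i /= ist; apply: Dx => /=.
    by rewrite mem_cat ist.
  by rewrite mem_cat ist orbT.
have [nMx _] := Dx [::]; apply: nMx.
suff -> : x = 1 by [].
apply: coord_inj => i; rewrite coord1; have [_ /(_ i)] := Dx [:: i : {classic I}].
by apply; rewrite /= inE.
Qed.

End Projections.

(** * Fitting's lemma and the exchange property *)

(** The analogue of the corner [hRh] of a ring: a monoid with identity [h], whose units are the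
    subject of [corner_unit]. *)
Definition corner (G : topologicalGroupType) (h f : G -> G) := nend f /\ below f h.

Definition corner_unit (G : topologicalGroupType) (h f : G -> G) :=
  exists t, corner h t /\ forall x, t (f x) = h x /\ f (t x) = h x.

Lemma nend_iter (G : topologicalGroupType) (f : G -> G) k : nend f -> nend (iter k f).
Proof.
move=> nf; elim: k => [|k IHk]; first exact: nend_id.
exact: (nend_comp IHk nf).
Qed.

Lemma corner_comp (G : topologicalGroupType) (h f g : G -> G) :
  corner h f -> corner h g -> corner h (fun x => g (f x)).
Proof.
move=> [nf fh] [ng gh]; split; first exact: nend_comp.
by move=> x; rewrite (gh _).1 (fh x).2.
Qed.

Section Fitting.
Variables (G : profiniteGroupType) (h : G -> G).
Hypotheses (fiG : fi_base G) (prim : primitive h).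

Let idh : idem_nend h. Proof. by case: prim. Qed.
Let nh : nend h. Proof. by case: idh. Qed.
Let hh x : h (h x) = h x. Proof. by case: idh. Qed.

(* Fitting's lemma.  The endomorphisms that commute with f and take values in
   the closures of the f-orbits form a compact semigroup S; an idempotent of
   S \o f is 1 or h by primitivity. *)
Lemma fitting f M : corner h f -> open M -> M 1 ->
  corner_unit h f \/ forall x, exists k, M (iter k f (h x)).
Proof.
move=> [nf fh] oM M1.
pose orbit x : set G := [set iter k f (h x) | k in [set: nat]].
pose S : set (endo_space G) := (@nend G : set (endo_space G)) `&`
  (\bigcap_x [set t : endo_space G | h (t x) = t x]) `&`
  (\bigcap_x [set t : endo_space G | t (h x) = t x]) `&`
  (\bigcap_x [set t : endo_space G | t (f x) = f (t x)]) `&`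
  (\bigcap_x [set t : endo_space G | closure (orbit x) (t x)]).
have ce := @endo_eval_continuous G.
have cc (u : G -> G) : nend u -> forall x, continuous (fun t : endo_space G => u (t x)).
  move=> nu x; apply: (continuous_compf (f := fun t : endo_space G => t x)) => //.
  exact: nend_continuous.
have clS : closed S.
  repeat apply: closedI; first exact: nend_closed.
  + apply: closed_bigI => x _; apply: closed_eq_group; [exact: cc|exact: ce].
  + by apply: closed_bigI => x _; apply: closed_eq_group; exact: ce.
  + apply: closed_bigI => x _; apply: closed_eq_group; [exact: ce|exact: cc].
  + apply: closed_bigI => x _.
    apply: (preimage_closed (f := fun t : endo_space G => t x)) => [t _|].
      exact: ce.
    exact: closed_closure.
have SE t : S t -> [/\ nend t, below t h, forall x, t (f x) = f (t x) &
    forall x, closure (orbit x) (t x)].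
  move=> [[[[nt ht] th] tf] tcl]; split => // x; last exact: tcl.
    by split; [exact: ht|exact: th].
  exact: tf.
have SI t : nend t -> below t h -> (forall x, t (f x) = f (t x)) ->
    (forall x, closure (orbit x) (t x)) -> S t.
  move=> nt th tf tcl; split; last by move=> x _; exact: tcl.
  split; last by move=> x _; exact: tf.
  split; last by move=> x _; exact: (th x).2.
  by split => // x _; exact: (th x).1.
have Sh : S h.
  apply: SI => // x; first by rewrite (fh x).1 (fh x).2.
  by apply: subset_closure; exists 0%N.
(* For the orbit condition: iterates of [f] map the closure of the orbit of [x] into itself, so the
   orbit closure of [t x] lies in that of [x]. *)
have Scomp s t : S s -> S t -> S (fun x => s (t x)).
  move=> /SE[ns sh sf scl] /SE[nt th tf tcl]; apply: SI.
  - exact: nend_comp.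
  - by move=> x; rewrite (sh _).1 (th _).2.
  - by move=> x; rewrite tf sf.
  - move=> x; have : closure (orbit (t x)) (s (t x)) by exact: scl.
    have -> : closure (orbit x) = closure (closure (orbit x)).
      exact/closure_id/closed_closure.
    apply: closureS => _ [k _ <-]; rewrite (th x).1.
    have : (iter k f @^-1` closure (orbit x)) (t x).
      have cl : closed (iter k f @^-1` closure (orbit x)).
        apply: preimage_closed (@closed_closure _ _) => y _.
        exact/nend_continuous/nend_iter.
      have := tcl x; move/closure_id: cl => ->; apply: closureS.
      move=> _ [l _ <-] /=; apply: subset_closure; exists (k + l)%N => //.
      by rewrite iterD.
    by [].
pose T : set (endo_space G) := [set ((fun x => t (f x)) : endo_space G) | t in S].
have clT : closed T.
  apply: compact_closed; first exact: endo_hausdorff.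
  apply: continuous_compact; last first.
    by apply: subclosed_compact clS (@endo_compact G) _.
  apply: continuous_subspaceT; apply: into_endo_continuous => x; exact: ce.
have Sf : S f.
  apply: SI => // x; apply: subset_closure; exists 1%N => //=.
  exact: (fh x).2.
have [||||e Te ee] := @ellis_idempotent (endo_space G) (fun s t x => s (t x)) _
    (@endo_compact G) (@endo_hausdorff G) _ T clT.
- by [].
- by move=> t; apply: into_endo_continuous => x; exact: ce.
- by exists (fun x => h (f x)), h.
- move=> _ _ [s Ss <-] [t St <-]; exists (fun x => s (f (t x))) => //.
  apply: (Scomp s (fun x => f (t x))) => //; exact: (Scomp f t).
have [t St te] := Te; have [nt th tf tcl] := SE _ St.
have tfe x : t (f x) = e x by rewrite -te.
have [ne eh _ _] : [/\ nend e, below e h, forall x, e (f x) = f (e x) &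
    forall x, closure (orbit x) (e x)].
  by apply: SE; rewrite -te; exact: Scomp.
have ide : idem_nend e by split => // x; have := congr1 (@^~ x) ee.
(* If [e = h], then [t] inverts [f] in the corner. If [e = 1], then [1 = t (f x)] lies in the
   closure of the orbit of [f x], so some iterate enters the neighbourhood [M] of [1]. *)
have [_ _ hprim] := prim; have [e1|eqh] := hprim _ ide eh; last first.
  by left; exists t; split => // x; rewrite -tf !tfe eqh.
right => x; have := tcl (f x); rewrite tfe e1 => cl.
have [|y [[k _ <-] My]] := cl M; first by apply: open_nbhs_nbhs.
by exists k.+1; rewrite iterSr (fh x).2 -[f x](fh x).1.
Qed.

(** The corner of a primitive idempotent behaves like a local ring. After dividing by [u] the two
    terms multiply to [h]; if neither is a unit, Fitting's lemma makes both contract every point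
    into [M] after some number of steps, which is contradictory. *)
Lemma corner_unit_sum f g u : corner h f -> corner h g ->
  (forall x, u x = f x * g x) -> corner h u -> corner_unit h u ->
  corner_unit h f \/ corner_unit h g.
Proof.
move=> cf cg ufg cu [v [cv vu]].
(* If [w] inverts [v \o k], then applying [u] gives [k \o w = u], so [w \o v] is a two-sided inverse
   of [k]. *)
have of_inverse k : corner h k -> corner_unit h (fun x => v (k x)) -> corner_unit h k.
  move=> ck [w [cw wk]]; exists (fun x => w (v x)); split; first exact: corner_comp.
  move=> x; split; first exact: (wk x).1.
  have E y : k (w y) = u y.
    have := congr1 u (wk y).2; rewrite (vu _).2 (ck.2 _).1 => ->.
    by rewrite (cu.2 y).2.
  by rewrite E (vu x).2.
have [_ [x0 hx0] _] := prim.
have [M fiM hM] := fi_base_separates fiG hx0.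
have oM := fi_open fiM; have M1 := fi_one fiM.
have cvf := corner_comp cf cv; have cvg := corner_comp cg cv.
have [uf|nf] := fitting cvf oM M1; first by left; exact: of_inverse.
have [ug|ng] := fitting cvg oM M1; first by right; exact: of_inverse.
set f' := (fun x => v (f x)) in cvf nf; set g' := (fun x => v (g x)) in cvg ng.
have fg' x : h x = f' x * g' x by rewrite -(vu x).1 ufg (nendM cv.1).
exfalso.
(* Along the iterates of [f'] from [h x0], which starts outside [M] and reaches it, take a point [y]
   just before an entry into [M]. *)
have [y [hy My Mfy]] : exists y, [/\ h y = y, ~ M y & M (f' y)].
  have [k Mk] := nf x0; elim: k Mk => [|k IHk] //= Mk.
  have [Mk'|nMk'] := pselect (M (iter k f' (h x0))); first exact: IHk.
  exists (iter k f' (h x0)); split => //.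
  by case: k {IHk Mk nMk'} => [|k] /=; [rewrite hh|rewrite (cvf.2 _).1].
have [l] := ng y; rewrite hy.
elim: l => [//|l IHl]; rewrite iterSr => Ml; apply: IHl.
have nl := nend_iter l cvg.1.
(* Splitting [y] as [f' y * g' y] with [f' y] in [M] shows that if the iterate [l.+1] of [g'] sends
   [y] into [M], so does the iterate [l]. Descending to [0] puts [y] itself in [M]. *)
have -> : iter l g' y = iter l g' (f' y) * iter l g' (g' y).
  by rewrite -(nendM nl) -fg' hy.
by apply: fi_mul => //; exact: fi_nend.
Qed.

End Fitting.

Lemma corner_compress (G : topologicalGroupType) (h k : G -> G) :
  idem_nend h -> nend k -> corner h (fun x => h (k (h x))).
Proof.
move=> [nh hh] nk; split; last by move=> x; rewrite !hh.
by apply: (nend_comp (f := fun x => k (h x))) => //; exact: nend_comp.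
Qed.

Section Exchange.
Variables (G : profiniteGroupType) (J : Type) (K : J -> profiniteGroupType).
Variables (f : G -> prod_topology K) (g : prod_topology K -> G).
Hypotheses (fiG : fi_base G) (mf : monoid_morphism f).
Hypotheses (cf : continuous f) (cg : continuous g).
Hypotheses (fK : cancel f g) (gK : cancel g f).
Notation pr := (proj f g).

(** The full projection compresses to the unit [h]. Coordinates from a finite support are split off
    one at a time by [corner_unit_sum], until a single coordinate gives a unit. *)
Lemma primitive_exchange (h : G -> G) : primitive h ->
  exists j, corner_unit h (fun x => h (pr [set j] (h x))).
Proof.
move=> prim; have [idh [x0 hx0] _] := prim; have [nh hh] := idh.
have [M fiM hM] := fi_base_separates fiG hx0.
have npr S : nend (pr S) by exact: proj_nend.
have cpr S : corner h (fun x => h (pr S (h x))) by exact: corner_compress.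
have [s sM] := finite_support mf cf fK (fi_open fiM) (fi_one fiM).
(* Invariant: [s] lists the coordinates still to be tried, and triviality on [s] and outside [S]
   forces membership in [M]. Once [s] is empty, the projection to [S] maps into [M], so it cannot
   compress to a unit. *)
suff : forall S : set J, (forall x, (forall j, j \in s -> f x j = 1) ->
    (forall j, ~ S j -> f x j = 1) -> M x) ->
    corner_unit h (fun x => h (pr S (h x))) ->
    exists j, corner_unit h (fun x => h (pr [set j] (h x))).
  move=> /(_ setT); apply; first by move=> x sx _; exact: sM.
  exists h; split; first by split => // x; rewrite hh.
  by move=> x; rewrite !(proj_setT fK gK) !hh.
elim: s {sM} => [|j s IHs] S sM.
  move=> [t [ct tf]]; exfalso; apply: hM; rewrite -(tf x0).1.
  apply: (fi_nend fiM ct.1); apply: (fi_nend fiM nh); apply: sM => // j nSj.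
  by rewrite (proj_coord gK) asboolF.
have [Sj|nSj] := pselect (S j); last first.
  apply: IHs => x sx Sx; apply: sM => // i; rewrite inE => /orP[/eqP->|]; last exact: sx.
  exact: Sx.
move=> uS.
have [|uj|uSj] := corner_unit_sum fiG prim (cpr [set j]) (cpr (S `\ j)) _ (cpr S) uS.
- by move=> x; rewrite (proj_split mf fK gK _ Sj) (nendM nh).
- by exists j.
- apply: (IHs (S `\ j)) => // x sx Sx; apply: sM => i.
    rewrite inE => /orP[/eqP->|]; last exact: sx.
    by apply: Sx => -[_]; apply.
  by move=> nSi; apply: Sx => -[/nSi].
Qed.

End Exchange.

(** * Cancelling a pair of exchanged factors *)

Section Cancellation.
Variables (G : profiniteGroupType) (I J : Type).
Variables (H : I -> profiniteGroupType) (K : J -> profiniteGroupType).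
Variables (f : G -> prod_topology H) (g : prod_topology H -> G).
Variables (f' : G -> prod_topology K) (g' : prod_topology K -> G).
Hypotheses (mf : monoid_morphism f) (cf : continuous f) (cg : continuous g).
Hypotheses (fK : cancel f g) (gK : cancel g f).
Hypotheses (mf' : monoid_morphism f') (cf' : continuous f') (cg' : continuous g').
Hypotheses (fK' : cancel f' g') (gK' : cancel g' f').
Variables (i : I) (j : J).
Notation h := (proj f g [set i]).
Notation k := (proj f' g' [set j]).
Hypotheses (primh : primitive h) (primk : primitive k).
Hypothesis hkh : corner_unit h (fun x => h (k (h x))).

Let nh : nend h. Proof. exact: proj_nend. Qed.
Let nk : nend k. Proof. exact: proj_nend. Qed.

(* k t k is a nonzero idempotent below k, where t inverts h k h in the corner
   of h, so it equals k. *)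
Let inverse_facts : exists2 t, nend t &
  [/\ forall x, h (t x) = t x, forall x, h x = x -> k x = 1 -> x = 1 &
    forall x, k (t (k x)) = k x].
Proof.
have [t [[nt th] tu]] := hkh; exists t => //.
have hh x : h (h x) = h x by have [_ ->] := proj_idem mf cf cg fK gK [set i].
have kk x : k (k x) = k x by have [_ ->] := proj_idem mf' cf' cg' fK' gK' [set j].
have tkt x : t (k (t x)) = t x.
  by rewrite -(th (k (t x))).2 -{1}(th x).1 (tu (t x)).1 (th x).1.
split; first by move=> x; rewrite (th x).1.
- by move=> x hx kx; have := (tu x).1; rewrite hx kx (nend1 nh) (nend1 nt) => ->.
- have ide : idem_nend (fun x => k (t (k x))).
    split; last by move=> x; rewrite kk tkt.
    by apply: (nend_comp (f := fun x => t (k x))) => //; exact: nend_comp.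
  have [_ _ kprim] := primk; have [|e1|//] := kprim _ ide.
    by move=> x; rewrite !kk.
  have [_ [x0 hx0] _] := primh; case: hx0.
  have kh1 : k (h x0) = 1.
    by rewrite -(e1 (h x0)) -(th (k (h x0))).2 (tu x0).1.
  by rewrite -(tu x0).1 kh1 (nend1 nh) (nend1 nt).
Qed.

(** The isomorphism is [k] restricted to the image of [h]: injective because [h k h] is invertible
    in the corner, surjective because [k t k = k] with [t] taking values in the image of [h]. *)
Lemma exchange_isomorphic : isomorphic (H i) (K j).
Proof.
have [t nt [ht hkI ktk]] := inverse_facts.
apply: (bijective_isomorphic (f := fun a => f' (coord_incl g a) j)).
- apply: (continuous_compf (f := fun a : H i => f' (coord_incl g a))
    (g := fun y : prod_topology K => y j)); last exact: coord_continuous.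
  by apply: continuous_compf => //; have [] := coord_retract mf cf cg fK gK i.
- have [_ mi _ _ _] := coord_retract mf cf cg fK gK i.
  split => [|a b]; first by rewrite mi.1 (coord1 mf').
  by rewrite mi.2 (coordM mf').
- move=> a a1; rewrite -[a](coord_inclK gK); set x := coord_incl g a.
  suff -> : x = 1 by rewrite (coord1 mf).
  apply: hkI; first by rewrite -(coord_inclE fK gK) (coord_inclK gK).
  rewrite -(coord_inclE fK' gK') a1.
  by have [_ [-> _] _ _ _] := coord_retract mf' cf' cg' fK' gK' j.
- move=> b; pose c := coord_incl g' b.
  have kc : k c = c by rewrite -(coord_inclE fK' gK') (coord_inclK gK').
  have ktc : k (t c) = c by have := ktk c; rewrite kc.
  exists (f (t c) i); rewrite (coord_inclE fK gK) ht.
  have := congr1 (fun z => f' z j) ktc.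
  by rewrite (proj_coord gK') asboolT// (coord_inclK gK').
Qed.

(** The kernel of [k], which is the product of the other [K] factors, complements the image of [h].
    Forgetting coordinate [i] therefore maps it bijectively onto the product of the other [H]
    factors. *)
Lemma exchange_complement_isomorphic :
  isomorphic (prod_topology (fun a : omit j => K (sval a)))
             (prod_topology (fun a : omit i => H (sval a))).
Proof.
have [t nt [ht hkI ktk]] := inverse_facts.
have mg' := cancel_morphism mf' fK' gK'.
pose inc (d : prod_topology (fun a : omit j => K (sval a))) : G := g' (extend d).
have minc : monoid_morphism inc.
  by apply: monoid_morphism_comp => //; exact: extend_morphism.
have cinc : continuous inc.
  by apply: continuous_compf => //; exact: extend_continuous.
have kinc d : k (inc d) = 1.
  apply: (coord_inj fK') => b; rewrite (proj_coord gK') gK' (coord1 mf').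
  by case: asboolP => // ->; exact: extend_eq.
apply: (bijective_isomorphic (f := fun d => forget (f (inc d)))).
- apply: (continuous_compf (f := fun d => f (inc d))); last exact: forget_continuous.
  exact: continuous_compf.
- apply: (monoid_morphism_comp (f := fun d => f (inc d))); last exact: forget_morphism.
  exact: monoid_morphism_comp.
- move=> d d1.
  suff inc1 : inc d = 1.
    rewrite -(extendK d) -[extend d]gK' -/(inc d) inc1 mf'.1.
    by [].
  apply: hkI => //; apply: (coord_inj fK) => a; rewrite (proj_coord gK).
  case: asboolP => // ai.
  have E : f (inc d) a = 1 := congr1 (@^~ (exist _ a ai : omit i)) d1.
  by rewrite E.
- move=> c; pose y := g (extend c).
  (* The correction lies in the image of [h], so it changes only coordinate [i]; by [k t k = k] it
     moves [y] into the kernel of [k]. *)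
  pose x := y * t (k y^-1).
  have kx : k x = 1 by rewrite /x (nendM nk) ktk (nendV _ nk) mulgV.
  exists (forget (f' x)).
  have -> : inc (forget (f' x)) = x.
    apply: (coord_inj fK') => b; rewrite gK' /extend; case: pselect => // bj.
    have -> : b = j by apply: contrapT.
    have := congr1 (fun z => f' z j) kx.
    by rewrite proj_coord// asboolT// (coord1 mf').
  apply: functional_extensionality_dep => a.
  rewrite -[LHS]/(f x (sval a)) (coordM mf) gK extend_neq -ht (proj_coord gK).
  by rewrite asboolF ?mulg1//; exact: svalP a.
Qed.

End Cancellation.

(** * Uniqueness *)

Lemma glue_bijection (I J T : Type) (u : I -> T) (v : J -> T) :
  (forall t, ([set i | u i = t] #= [set j | v j = t])%card) ->
  exists h : I -> J, bijective h /\ forall i, v (h i) = u i.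
Proof.
move=> uv.
pose A t := [set i | u i = t]; pose B t := [set j | v j = t].
have bijt t : exists f : A t -> B t, bijective f by apply/card_bijP; exact: uv.
pose f t := sval (cid (bijt t)); have fbij t : bijective (f t) by exact: svalP (cid _).
pose elt t i (ui : u i = t) : A t := SigSub (mem_set (ui : A t i)).
pose h i := val (f _ (elt _ i erefl)).
(* Lets [i] and [i'] in one fibre be compared through the same chosen bijection, although [h] uses
   the one indexed by [u i]. *)
have hE t i (ui : u i = t) : h i = val (f t (elt t i ui)) by case: _ / ui.
have vh i : v (h i) = u i by have /set_mem := valP (f _ (elt _ i erefl)).
have hI : injective h.
  move=> i i' hii; have ui : u i = u i' by rewrite -!vh hii.
  have := hii; rewrite (hE _ _ ui) (hE _ i' erefl) => /val_inj.
  by move=> /(bij_inj (fbij _))/(congr1 val).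
have /choice[g gK] : forall j, exists i, h i = j.
  move=> j; have [fi fK fiK] := fbij (v j).
  pose x := fi (SigSub (mem_set (erefl : B (v j) j))).
  have ux : u (val x) = v j by have /set_mem := valP x.
  exists (val x); rewrite (hE _ _ ux).
  have -> : elt _ _ ux = x by exact: val_inj.
  by rewrite fiK.
exists h; split => //; exists g => // i; apply: hI; exact: gK.
Qed.

Lemma iso_decomposition (G G' : profiniteGroupType) (I : Type)
    (H : I -> profiniteGroupType) :
  isomorphic G' G -> indecomposable_decomposition G H ->
  indecomposable_decomposition G' H.
Proof. by move=> GG' [Hi GH]; split => //; exact: isomorphic_trans GH. Qed.

Lemma decomposition_exchange (G : profiniteGroupType) (I J : Type)
    (H : I -> profiniteGroupType) (K : J -> profiniteGroupType) (i : I) :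
  fi_base G -> indecomposable_decomposition G H ->
  indecomposable_decomposition G K ->
  exists j, isomorphic (H i) (K j) /\
    isomorphic (prod_topology (fun a : omit i => H (sval a)))
               (prod_topology (fun a : omit j => K (sval a))).
Proof.
move=> fiG [Hi [f [g [mf cf cg fK gK]]]] [Ki [f' [g' [mf' cf' cg' fK' gK']]]].
have primh := proj_primitive mf cf cg fK gK (Hi i).1 (Hi i).2.
have [j hkh] := primitive_exchange fiG mf' cf' cg' fK' gK' primh.
have primk := proj_primitive mf' cf' cg' fK' gK' (Ki j).1 (Ki j).2.
exists j; split.
  exact: (exchange_isomorphic mf cf cg fK gK mf' cf' cg' fK' gK' primh primk hkh).
apply: isomorphic_sym.
exact: (exchange_complement_isomorphic mf cf cg fK gK mf' cf' cg' fK' gK' primh primk hkh).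
Qed.

Lemma fi_base_omit (G : profiniteGroupType) (I : Type)
    (H : I -> profiniteGroupType) (i : I) :
  fi_base G -> isomorphic G (prod_topology H) ->
  fi_base (prod_topology (fun a : omit i => H (sval a))).
Proof.
move=> fiG [f [g [mf cf cg fK gK]]]; have mg := cancel_morphism mf fK gK.
apply: (fi_base_retract (i := fun d => g (extend d)) (p := fun x => forget (f x)) _ _ _ _ _ fiG).
- by apply: continuous_compf => //; exact: extend_continuous.
- by apply: monoid_morphism_comp => //; exact: extend_morphism.
- by apply: (continuous_compf (f := f)) => //; exact: forget_continuous.
- by apply: (monoid_morphism_comp (f := f)) => //; exact: forget_morphism.
- by move=> d; rewrite gK extendK.
Qed.

(** Induction on [m]: exchange the factor at [a ord0] for some [K j] and cancel the pair. The group
    [G] is quantified inside because cancelling replaces it by the product of the remaining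
    factors. *)
Lemma class_injection (C : profiniteGroupType -> Prop) (m : nat) :
  (forall A B : profiniteGroupType, isomorphic A B -> C A -> C B) ->
  forall (G : profiniteGroupType) (I J : Type)
    (H : I -> profiniteGroupType) (K : J -> profiniteGroupType),
  fi_base G -> indecomposable_decomposition G H ->
  indecomposable_decomposition G K ->
  forall a : 'I_m -> I, injective a -> (forall r, C (H (a r))) ->
  exists2 b : 'I_m -> J, injective b & forall r, C (K (b r)).
Proof.
move=> Ciso; elim: m => [|m IHm] G I J H K fiG dH dK a aI Ca.
  have b : 'I_0 -> J by case.
  by exists b => [[]|[]].
have [j [Hij rest]] := decomposition_exchange (a ord0) fiG dH dK.
have ane r : a (lift ord0 r) <> a ord0.
  by move=> /aI/esym/eqP; rewrite (negbTE (neq_lift ord0 r)).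
pose a' r : omit (a ord0) := exist _ (a (lift ord0 r)) (ane r).
have [||r s|r|b bI Cb] := IHm _ _ _ (fun a : omit (a ord0) => H (sval a))
    (fun a : omit j => K (sval a)) (@fi_base_omit _ _ _ (a ord0) fiG dH.2) _ _ a' _ _.
- split; last exact: isomorphic_refl.
  by move=> k; exact: dH.1.
- apply: (iso_decomposition rest).
  by split; [move=> k; exact: dK.1|exact: isomorphic_refl].
- by move=> /(congr1 sval)/aI/lift_inj.
- exact: Ca.
exists (fun r => if unlift ord0 r is Some s then sval (b s) else j).
- move=> r s; case: unliftP => [r' ->|->]; case: unliftP => [s' ->|->] //.
  + move=> E; congr lift; apply: bI.
    by case: (b r') (b s') E => x xj [y yj] /= E; apply: eq_exist.
  + by move=> E; case: (svalP (b r')).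
  + by move=> E; case: (svalP (b s')).
- move=> r; case: unliftP => [s _|_]; first exact: Cb.
  exact: Ciso Hij (Ca ord0).
Qed.

(** Fix a nontrivial element of one factor of the class and [M] avoiding it. In a factor of the
    class off the finite support of [M], the corresponding element lies in [M], and an endomorphism
    of [G] carries it back to the fixed one, against full invariance. *)
Lemma finite_class (G : profiniteGroupType) (I : Type)
    (H : I -> profiniteGroupType) (A : profiniteGroupType) :
  fi_base G -> indecomposable_decomposition G H ->
  finite_set [set i | isomorphic A (H i)].
Proof.
move=> fiG [Hi [f [g [mf cf cg fK gK]]]].
have [[i0 Ai0]|none] := pselect (exists i, isomorphic A (H i)); last first.
  suff -> : [set i | isomorphic A (H i)] = set0 by exact: finite_set0.
  by rewrite -subset0 => i Ai; apply: none; exists i.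
have [c c1] : exists c : H i0, c <> 1.
  apply: contrapT => nc; apply: (Hi i0).1 => c; apply: contrapT => c1.
  by apply: nc; exists c.
have incl i := coord_retract mf cf cg fK gK i.
pose x0 := coord_incl g c.
have x01 : x0 <> 1.
  by move/(congr1 (fun x => f x i0)); rewrite (coord_inclK gK) (coord1 mf).
have [M fiM Mx0] := fi_base_separates fiG x01.
have [s sM] := finite_support mf cf fK (fi_open fiM) (fi_one fiM).
apply: (@sub_finite_set _ _ ([set` s] : set I)); last exact: (@finite_seq {classic I}).
move=> i Ai /=; apply: contrapT => /negP nis; apply: Mx0.
have [p [q [mp cp cq pK qK]]] := isomorphic_trans (isomorphic_sym Ai0) Ai.
have [ci mi cp0 mp0 _] := incl i0; have [_ _ cpi mpi _] := incl i.
have My : M (coord_incl g (p c)).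
  apply: sM => k ks; rewrite gK single_neq// => ik.
  by move: nis; rewrite ik ks.
have [_ _ _ Mf] := fiM.
have := Mf (fun x => coord_incl g (q (f x i))) _ _ _ My.
rewrite /= (coord_inclK gK) pK; apply.
- apply: (continuous_compf (f := fun x => q (f x i))) => //.
  exact: (continuous_compf (f := fun x => f x i)).
- apply: (monoid_morphism_comp (f := fun x => q (f x i))) => //.
  apply: (monoid_morphism_comp (f := fun x => f x i)) => //.
  exact: cancel_morphism mp pK qK.
Qed.

Lemma class_card_le (G : profiniteGroupType) (I J : Type)
    (H : I -> profiniteGroupType) (K : J -> profiniteGroupType)
    (A : profiniteGroupType) :
  fi_base G -> indecomposable_decomposition G H ->
  indecomposable_decomposition G K ->
  ([set i | isomorphic A (H i)] #<= [set j | isomorphic A (K j)])%card.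
Proof.
move=> fiG dH dK.
have /finite_setP[m Am] := finite_class A fiG dH.
have mA := card_eq_trans (card_esym (@card_II m)) (card_esym Am).
have /card_bijP[p pbij] := mA.
pose a r := val (p (SigSub (mem_set (Logic.I : [set: 'I_m] r)))).
have aI : injective a.
  by move=> r s /val_inj/(bij_inj pbij)/(congr1 val).
have Aa r : isomorphic A (H (a r)) by have /set_mem := valP (p (SigSub (mem_set (Logic.I : [set: 'I_m] r)))).
have [|b bI Ab] := class_injection (C := fun B => isomorphic A B) _ fiG dH dK aI Aa.
  by move=> B B' BB' AB; exact: isomorphic_trans BB'.
have /andP[_ le1] : ([set: 'I_m] #<= [set i | isomorphic A (H i)])%card &&
    ([set i | isomorphic A (H i)] #<= [set: 'I_m])%card by rewrite -card_eq_le.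
have bm : (b @` [set: 'I_m] #= [set: 'I_m])%card by apply: inj_card_eq => r s _ _; exact: bI.
apply: (card_le_trans le1); rewrite -(card_le_eql bm); apply: subset_card_le.
by move=> _ [r _ <-]; exact: Ab.
Qed.

Lemma decomposition_unique (G : profiniteGroupType) (I J : Type)
    (H : I -> profiniteGroupType) (K : J -> profiniteGroupType) :
  fi_base G -> indecomposable_decomposition G H ->
  indecomposable_decomposition G K ->
  exists h : I -> J, bijective h /\ forall i, isomorphic (H i) (K (h i)).
Proof.
move=> fiG dH dK.
(* By extensionality, the predicate [cl A] serves as a label of the isomorphism class of [A], and
   the fibres of the labels are compared. *)
pose cl (A B : profiniteGroupType) : Prop := isomorphic A B.
have clP (A B : profiniteGroupType) : cl A = cl B <-> isomorphic A B.
  split=> [AB|AB].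
    have : cl A B by rewrite AB; exact: isomorphic_refl.
    by [].
  apply/funext => C; apply/propext; split; apply: isomorphic_trans => //.
  exact: isomorphic_sym.
have [|h [hbij clh]] := @glue_bijection I J _ (cl \o H) (cl \o K).
  move=> t; have [[A tA]|none] := pselect (exists A, t = cl A); last first.
    suff [-> ->] : [set i | (cl \o H) i = t] = set0 /\ [set j | (cl \o K) j = t] = set0.
      exact: card_eq00.
    by split; rewrite -subset0 => i ti; apply: none; eexists; rewrite -ti.
  have E L (F : L -> profiniteGroupType) :
      [set i | (cl \o F) i = t] = [set i | isomorphic A (F i)].
    rewrite tA eqEsubset; split => i /= => [/clP|AF]; first exact: isomorphic_sym.
    by apply/clP; exact: isomorphic_sym.
  by rewrite !E card_eq_le !(class_card_le _ fiG).
by exists h; split => // i; apply/clP; exact: esym (clh i).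
Qed.

(** * Existence *)

Section Existence.
Variable G : profiniteGroupType.
Hypothesis Gsmall : small G.

Let fiG : fi_base G. Proof. exact: small_fi_base. Qed.

Lemma residual_separates (x : G) : x <> 1 -> exists n, ~ residual n x.
Proof.
by move=> /nbhs1_setC1/residual_base[n nx]; exists n => /nx; apply.
Qed.

(** Take [n] minimal with [r] not mapping into [residual n], and a primitive [a] below [r] with the
    same property. As residuals decrease, [a] is then visible at every level where [r] is. For
    trivial [r] the answer is the trivial map, so that the recursion never stops. *)
Lemma split_primitive (r : G -> G) : idem_nend r ->
  exists a, [/\ idem_nend a, below a r, primitive a \/ (forall x, a x = 1) &
    forall n, (exists x, ~ residual n (r x)) -> exists x, ~ residual n (a x)].
Proof.
move=> idr; have [[x0 rx0]|r1] := pselect (exists x, r x <> 1); last first.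
  have {}r1 x : r x = 1 by apply: contrapT => rx; apply: r1; exists x.
  exists (fun=> 1); split; [by split; [exact: nend_cst1|]|..].
  - by move=> x; rewrite r1.
  - by right.
  - by move=> n [x []]; rewrite r1; exact: fi_one (residual_fi _ Gsmall).
have [n0 rn0] := residual_separates rx0.
have exn : exists n, `[< exists x, ~ residual n (r x) >].
  by exists n0; apply/asboolP; exists x0.
case: (ex_minnP exn) => n /asboolP rn nmin.
have [a [pa ar [x ax]]] := exists_primitive fiG (residual_fi n Gsmall) idr rn.
exists a; split => //; [by case: pa|by left|].
move=> m rm; exists x => am; apply: ax; apply: residual_decreasing am.
by apply: nmin; apply/asboolP.
Qed.

Let state := {r : G -> G | idem_nend r}.

Let head_spec (s : state) (a : G -> G) :=
  [/\ idem_nend a, below a (sval s), primitive a \/ (forall x, a x = 1) &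
    forall n, (exists x, ~ residual n (sval s x)) -> exists x, ~ residual n (a x)].

Let head_exists : exists head : state -> G -> G, forall s, head_spec s (head s).
Proof.
have /choice[a aP] : forall s : state, exists a, head_spec s a.
  by move=> [r idr]; exact: split_primitive.
by exists a.
Qed.

Lemma indecomposable_decomposition_exists :
  exists (I : set nat) (F : I -> profiniteGroupType), indecomposable_decomposition G F.
Proof.
have [head headP] := head_exists.
have hid s : idem_nend (head s) by have [] := headP s.
have hbelow s : below (head s) (sval s) by have [] := headP s.
pose next (s : state) : state :=
  exist _ _ (complement_idem (svalP s) (hid s) (hbelow s)).
have id1 : idem_nend (@id G) by split => //; exact: nend_id.
pose rem k : state := iter k next (exist _ id id1).
(* [a k] projects onto the factor split off at stage [k], [r k] onto what remained before it. *)
pose r k := sval (rem k); pose a k := head (rem k).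
have idr k : idem_nend (r k) := svalP (rem k).
have ida k : idem_nend (a k) := hid (rem k).
have na k : nend (a k) := (ida k).1.
have aa k x : a k (a k x) = a k x := (ida k).2 x.
have ar k : below (a k) (r k) := hbelow (rem k).
have mul_ar k x : a k x * r k.+1 x = r k x by exact: mul_complement.
have rr k l : k <= l -> below (r l) (r k).
  elim: l => [|l IHl]; first by rewrite leqn0 => /eqP-> x; rewrite (idr 0%N).2.
  rewrite leq_eqVlt => /orP[/eqP->|kl] x; first by rewrite (idr l.+1).2.
  have rS z : r l (r l.+1 z) = r l.+1 z := (below_complementP (idr l) (ar l) z).1.
  have Sr z : r l.+1 (r l z) = r l.+1 z := (below_complementP (idr l) (ar l) z).2.
  by split; [rewrite -rS (IHl kl _).1|rewrite -Sr (IHl kl x).2 Sr].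
(* The earlier projection kills the next remainder, and is killed by it; the later projection is
   below that remainder. *)
have orth k l x : k != l -> a k (a l x) = 1.
  rewrite neq_ltn => /orP[kl|lk].
    have <- : r k.+1 (a l x) = a l x by rewrite -(ar l x).1 (rr _ _ kl _).1.
    exact: below_complement (ida k) (ar k) _.
  rewrite -(ar k (a l x)).2 -(rr _ _ lk (a l x)).2.
  have -> : r l.+1 (a l x) = 1 by exact: complement_below (ida l) (ar l) _.
  by rewrite !nend1//; have [] := idr k.
have coeff (c : nat -> G) : (forall k, a k (c k) = c k) ->
    (* [y l] is the partial product of [c 0] up to [c l.-1]. *)
    exists y : nat -> G, forall k l, a k (y l) = if k < l then c k else 1.
  move=> ac; pose y l := iteri l (fun k z => z * c k) 1.
  exists y => k; elim=> [|l IHl] /=; first by rewrite (nend1 (na k)).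
  rewrite (nendM (na k)) -/(y l) IHl -(ac l) ltnS (leq_eqVlt k l).
  have [->|kl] := eqVneq k l; first by rewrite ltnn mul1g ac.
  by rewrite orth// mulg1.
(* Otherwise every [a k] is visible modulo [residual n]. The partial products are then pairwise
   incongruent, since [a k] kills [y k] but not [y l] modulo [residual n] for [k < l], against
   finite index. *)
have shrink n : exists k, forall x, residual n (r k x).
  apply: contrapT => nr.
  have vis k : exists x, ~ residual n (a k x).
    have [_ _ _] := headP (rem k); apply; apply: contrapT => nx; apply: nr; exists k => x.
    by apply: contrapT => rx; apply: nx; exists x.
  have fin := residual_fi n Gsmall.
  have /choice[c cP] := vis.
  have [y yP] := coeff (fun k => a k (c k)) (fun k => aa k (c k)).
  have [s sP] := open_subgroup_transversal (fi_open fin) (fi_one fin).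
  have /choice[z zP] : forall k, exists z, z \in s /\ residual n (z^-1 * y k).
    by move=> k; have [z zs zy] := sP (y k); exists z.
  have zI k l : k < l -> z k = z l -> False.
    move=> kl zkl; apply: (cP k).
    have : residual n (a k ((y k)^-1 * y l)).
      apply: (fi_nend fin (na k)).
      have -> : (y k)^-1 * y l = ((z k)^-1 * y k)^-1 * ((z l)^-1 * y l).
        by rewrite zkl invgM invgK -mulgA mulVKg.
      by apply: (fi_mul fin); [apply: (fi_inv fin)|]; exact: (zP _).2.
    by rewrite (nendM (na k)) (nendV _ (na k)) !yP ltnn kl invg1 mul1g.
  have /finite_setPn := @finite_seq _ s; apply.
  have zs : z @` [set: nat] `<=` [set` s] by move=> _ [k _ <-]; case: (zP k).
  have zcard : (z @` [set: nat] #= [set: nat])%card.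
    apply: inj_card_eq => k l _ _ zkl; apply/eqP; apply: contraT.
    rewrite neq_ltn => /orP[kl|lk]; exfalso; first exact: zI kl zkl.
    exact: zI lk (esym zkl).
  by rewrite -(card_le_eql zcard); exact: subset_card_le.
pose I := [set k | exists x, a k x <> 1].
pose F (k : I) : profiniteGroupType := fix_group (ida (val k)).
exists I, F; split.
  move=> k; have /set_mem[x akx] := valP k.
  apply/(primitive_retract (fix_normal_retract (ida (val k)))).
  have [_ _ [+|a1] _] := headP (rem (val k)); first by [].
  by case: akx; exact: a1.
apply: (bijective_isomorphic (f := fun x => (fun k => fix_retract (ida (val k)) x) : prod_topology F)).
- by apply: into_prod_continuous => k; exact: fix_retract_continuous.
- split => [|x y]; apply: functional_extensionality_dep => k.
    exact: monoid_morphism1 (fix_retract_morphism _).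
  exact: monoid_morphismM (fix_retract_morphism _) _ _.
(* If all [a k x] are trivial, every remainder fixes [x], so by [shrink] it lies in all
   residuals. *)
- move=> x x1.
  have ax k : a k x = 1.
    apply: contrapT => akx; have kI : I k by exists x.
    have := congr1 (fun d : prod_topology F => fix_val (d (SigSub (mem_set kI)))) x1.
    by rewrite /= fix_retractK => E; apply: akx; rewrite E; exact: monoid_morphism1 (fix_val_morphism _).
  have rx k : r k x = x.
    by elim: k => [//|k IHk]; rewrite -[RHS]IHk -(mul_ar k x) ax mul1g.
  apply: contrapT => /residual_separates[n]; apply.
  by have [k kn] := shrink n; rewrite -(rx k).
- move=> d.
  (* The value [1] at the dropped indices keeps [a k (c k) = c k] there. *)
  pose c k := if pselect (I k) is left kI then fix_val (d (SigSub (mem_set kI))) else 1.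
  have cE (k : I) : c (val k) = fix_val (d k).
    case: k => k kI; rewrite /c /=; case: pselect => [kI'|]; last first.
      by case; exact/set_mem.
    by rewrite (Prop_irrelevance (mem_set kI') kI).
  have ac k : a k (c k) = c k.
    have [kI|nkI] := pselect (I k); last by rewrite /c; case: pselect => // _; rewrite nend1.
    by have := cE (SigSub (mem_set kI)) => /= ->; exact: fix_valP.
  have [y yP] := coeff _ ac.
  (* The partial product [y m] has the first [m] components right; compactness gives a point with
     all of them right. *)
  have [|||x xP] := @directed_closed_nonempty G nat 0%N
      (fun m => [set x | forall k, k < m -> a k x = c k]) (@profinite_compact G).
  + move=> m; have -> : [set x | forall k, k < m -> a k x = c k] =
        \bigcap_(k in [set k | k < m]) [set x | a k x = c k] by [].
    apply: closed_bigI => k _; apply: closed_eq_group; last exact: continuous_const.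
    exact: nend_continuous.
  + by move=> m; exists (y m) => k km; rewrite yP km.
  + move=> m m'; exists (maxn m m') => x xm; split => k km; apply: xm.
      exact: leq_trans km (leq_maxl _ _).
    exact: leq_trans km (leq_maxr _ _).
  exists x; apply: functional_extensionality_dep => k; apply: fix_val_inj.
  by rewrite fix_retractK -cE; exact: (xP (val k).+1).
Qed.

End Existence.

Theorem theorem2 (G : profiniteGroupType) (Gsmall : small G) :
  (exists (I : set nat) (F : I -> profiniteGroupType),
     indecomposable_decomposition G F) /\
  (forall (I J : Type) (H : I -> profiniteGroupType) (K : J -> profiniteGroupType),
     indecomposable_decomposition G H -> indecomposable_decomposition G K ->
     exists h : I -> J, bijective h /\ forall i : I, isomorphic (H i) (K (h i))).
Proof.
split; first exact: indecomposable_decomposition_exists.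
by move=> I J H K dH dK; apply: (decomposition_unique _ dH dK); exact: small_fi_base.
Qed.
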